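(* For any $\gamma>0$ and integer $d\ge3$ there exists $\delta=\delta(\gamma,d)>0$ such that, for every Cayley graph $G$ with degree $d$ and external vertex Cheeger constant $\gamma$, and any FIID or weak FIID site percolation $X$ on $G$, the infinite clusters of $X$ whose average degree is at least $d(1-\delta)$ are indistinguishable: for every $\Gamma$-invariant Borel set $\mathcal A\subseteq\{0,1\}^{V(G)}$, either almost surely all infinite clusters of $X$ of average degree at least $d(1-\delta)$ are in $\mathcal A$, or almost surely none of them is.
   Context: $G=\mathrm{Cay}(\Gamma,S)$ with $\Gamma$ an infinite group and $S$ a finite symmetric generating set; $o$ is the vertex of the identity. The external vertex Cheeger constant of $G$ is $\inf_W |\partial_V^{\mathrm{ext}}W|/|W|$ over finite nonempty $W\subset V(G)$, where $\partial_V^{\mathrm{ext}}W$ is the set of vertices outside $W$ with a neighbour in $W$. A site percolation $X$ is a random subset of $V(G)$ (element of $\{0,1\}^{V(G)}$) with $\Gamma$-invariant law. FIID: $X=F(U)$ with $U$ i.i.d. $\mathrm{Unif}[0,1]$ labels on $V(G)$ or $E(G)$ and $F$ measurable and $\Gamma$-equivariant. Weak FIID: the law of $X$ is a weak limit (product topology) of laws of FIID site percolations. Clusters are the connected components of the subgraph of $G$ induced by $X$, viewed as subsets of $V(G)$; $\mathcal C_o$ is the cluster of $o$, and $\deg_X(o)$ is the number of neighbours of $o$ in $X$. Average degree of a cluster: let $\mathcal I$ be the $\sigma$-field generated by the events $\{\mathcal C_o\in\mathcal A\}$, $\mathcal A\subseteq\{0,1\}^{V(G)}$ Borel and $\Gamma$-invariant,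 under the law conditioned on $o\in X$. Then $\mathbb E[\deg_X(o)\mid\mathcal I]=\varphi(\mathcal C_o)$ for a $\Gamma$-invariant Borel function $\varphi$, and the average degree of a cluster $\mathcal C$ is $\varphi(\mathcal C)$. Almost surely it equals $\lim_N\frac1N\sum_{n<N}\deg_X(Y_n)$ for the delayed simple random walk $(Y_n)$ on the cluster (at each step choose a uniform random neighbour in $G$, move there if it is in $X$, otherwise stay). *)

(* Defs.v *)
From HB Require Import structures.
From mathcomp Require Import all_boot all_order all_algebra finmap.
From mathcomp Require Import all_classical all_reals all_analysis.

Set Implicit Arguments.
Unset Strict Implicit.
Unset Printing Implicit Defensive.

Import Order.TTheory GRing.Theory Num.Theory.
Import numFieldNormedType.Exports.

Local Open Scope classical_set_scope.
Local Open Scope fset_scope.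
Local Open Scope ring_scope.

Section CayleyGraph.
Variable G : groupType.
Implicit Types (S W : {fset G}) (x y g : G).

Definition symmetric_fset S := forall s, s \in S -> (s^-1)%g \in S.

Definition generating S := forall H : {pred G},
  group_closed H -> {subset S <= H} -> forall x, x \in H.

(* The Cayley graph is simple: a possible identity in S gives no loop.
   Edges are {x, x * s}, so that G acts by left multiplication. *)
Definition neighbours S x : {fset G} := [fset (x * s)%g | s in S] `\ x.

Definition adjacent S : rel G := fun x y => y \in neighbours S x.

Definition graph_degree S (d : nat) := forall x, #|` neighbours S x| = d.

Definition ext_boundary S W : {fset G} :=
  (\bigcup_(x <- W) neighbours S x) `\` W.

Definition ext_vertex_cheeger (R : realType) S : R :=
  inf [set r | exists2 W : {fset G},
    W != fset0 & r = #|` ext_boundary S W|%:R / #|` W|%:R].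

Definition edge_pred S : pred {fset G} :=
  fun e => `[< exists x y, adjacent S x y /\ e = [fset x; y] >].

Definition edge S := {e : {fset G} | edge_pred S e}.

Lemma neighbours_mul S g x y :
  y \in neighbours S x -> (g * y)%g \in neighbours S (g * x)%g.
Proof.
rewrite /neighbours !in_fsetD1 => /andP[yx /imfsetP[/= s sS ys]].
rewrite (inj_eq (mulgI g)) yx /=; apply/imfsetP; exists s => //=.
by rewrite ys mulgA.
Qed.

Lemma edge_mul_subproof S g (e : edge S) :
  edge_pred S [fset (g * x)%g | x in val e].
Proof.
case: e => e /= /asboolP[x [y [xy ->]]]; apply/asboolP.
exists (g * x)%g, (g * y)%g; split; first exact: neighbours_mul.
apply/fsetP => z; rewrite in_fset2; apply/imfsetP/orP => /=.
  by move=> [u]; rewrite in_fset2 => /orP[]/eqP-> ->; [left|right].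
by case=> /eqP ->; [exists x|exists y] => //; rewrite in_fset2 eqxx ?orbT.
Qed.

Definition edge_mul S g (e : edge S) : edge S :=
  exist (edge_pred S) _ (edge_mul_subproof g e).

End CayleyGraph.

(* {0,1}^V with the product topology and its Borel sigma-algebra. *)
Definition config (G : Type) : Type := {ptws G -> bool}.

HB.instance Definition _ (G : Type) := Pointed.on (config G).
HB.instance Definition _ (G : Type) := Topological.on (config G).
HB.instance Definition _ (G : Type) :=
  Measurable.copy (config G) (g_sigma_algebraType (@open (config G))).

(* [0,1]-labellings are extended to real labellings; uniform labels lie in
   [0,1] almost surely.  The sigma-algebra is the product one. *)
Definition labelling (I : Type) (R : realType) : Type := I -> R.

HB.instance Definition _ (I : Type) (R : realType) :=
  Pointed.on (labelling I R).
HB.instance Definition _ (I : Type) (R : realType) :=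
  Measurable.copy (labelling I R) (g_sigma_algebraType
    (\bigcup_i preimage_set_system [set: labelling I R]
                 (fun u => u i) measurable)).

Section Configurations.
Variable G : groupType.
Implicit Types (x C : config G) (A : set (config G)).

Definition translate (g : G) x : config G := fun v => x (g^-1 * v)%g.

Definition invariant_set A := forall g x, A (translate g x) <-> A x.

Definition invariant_fun (T : Type) (f : config G -> T) :=
  forall g x, f (translate g x) = f x.

Definition occupied (v : G) : set (config G) := [set x | x v].

Lemma measurable_occupied v : measurable (occupied v).
Proof.
apply: sub_sigma_algebra.
have -> : occupied v = @proj G (fun=> bool) v @^-1` [set true].
  by apply/seteqP; split=> x /=; rewrite /occupied/= /proj; case: (x v).
by apply: open_comp; [move=> x _; exact: proj_continuous|exact: discrete_open].
Qed.

Definition infinite_config C := infinite_set [set v | C v].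

Variable S : {fset G}.

(* empty if v is not in x *)
Definition cluster_of x (v : G) : config G := fun w =>
  `[< exists p : seq G,
        [/\ path (adjacent S) v p, all (fun u => x u) (v :: p)
          & last v p = w] >].

Definition is_cluster x C := exists2 v, x v & C = cluster_of x v.

Definition deg_in x (v : G) : nat := #|` [fset u in neighbours S v | x u]|.

End Configurations.

Section Percolation.
Variables (R : realType) (G : groupType) (S : {fset G}).
Implicit Types mu : probability (config G) R.

Definition site_percolation mu := forall g (B : set (config G)),
  measurable B -> mu (translate g @^-1` B) = mu B.

Definition mutually_independent d (T : measurableType d)
    (Q : probability T R) (I : choiceType) (U : I -> {RV Q >-> R}) :=
  forall (J : {fset I}) (B : I -> set R), (forall i, measurable (B i)) ->
    Q (\bigcap_(i in [set` J]) (U i @^-1` B i)) =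
    (\prod_(i <- J) fine (Q (U i @^-1` B i)))%:E.

Definition iid_uniform d (T : measurableType d)
    (Q : probability T R) (I : choiceType) (U : I -> {RV Q >-> R}) :=
  mutually_independent U /\
  forall i (B : set R), measurable B ->
    distribution Q (U i) B = uniform_prob (@ltr01 R) B.

(* mu is the law of F(U), for U iid uniform labels on a G-set I and F
   measurable and G-equivariant *)
Definition factor_of_iid_on (I : choiceType) (act : G -> I -> I) mu :=
  exists d (T : measurableType d) (Q : probability T R)
         (U : I -> {RV Q >-> R}) (F : labelling I R -> config G),
  [/\ iid_uniform U,
      measurable_fun [set: labelling I R] F,
      forall g u, F (fun i => u (act (g^-1)%g i)) = translate g (F u)
    & forall B, measurable B -> mu B = Q [set t | B (F (fun i => U i t))]].

Definition fiid mu :=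
  factor_of_iid_on (fun g v : G => (g * v)%g) mu \/
  factor_of_iid_on (@edge_mul G S) mu.

Definition converges_weakly (nu : nat -> probability (config G) R) mu :=
  forall f : config G -> R, continuous f ->
    (\int[nu n]_x (f x)%:E @[n --> \oo] --> \int[mu]_x (f x)%:E)%E.

Definition weak_fiid mu :=
  exists2 nu : nat -> probability (config G) R,
    forall n, fiid (nu n) & converges_weakly nu mu.

(* g is a version of the conditional expectation of f given the
   sub-sigma-algebra I *)
Definition is_cond_expectation d (T : measurableType d)
    (Q : probability T R) (I : set (set T)) (f g : T -> R) :=
  [/\ forall Y : set R, measurable Y -> I (g @^-1` Y),
      Q.-integrable [set: T] (EFin \o g)
    & forall E, I E ->
        (\int[Q]_(x in E) (g x)%:E = \int[Q]_(x in E) (f x)%:E)%E].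

(* the law mu conditioned on o \in X (mu itself if that event is null) *)
Definition cond_law mu : probability (config G) R :=
  mnormalize (mrestr mu (measurable_occupied 1%g)) mu.

Definition cluster_sigma_field : set (set (config G)) :=
  <<s [set E | exists A : set (config G),
         [/\ measurable A, invariant_set A
           & E = [set x | A (cluster_of S x 1%g)]]] >>.

(* phi is determined by mu up to a null set of clusters *)
Definition is_average_degree mu (phi : config G -> R) :=
  [/\ measurable_fun [set: config G] phi,
      invariant_fun phi
    & is_cond_expectation (cond_law mu) cluster_sigma_field
        (fun x => (deg_in S x 1%g)%:R) (fun x => phi (cluster_of S x 1%g))].

End Percolation.

(* Main.v *)
Require Import Defs.
From mathcomp Require Import all_boot all_order all_algebra finmap.
From mathcomp Require Import all_classical all_reals all_analysis.
From mathcomp Require Import lra ring.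

(** A factor of i.i.d. [f] has a spectral gap.  If [f] depends on finitely many
    labels, [phi g = Cov (f, g . f)] is a positive definite function on the
    group with finite support, and
      |T^n f|^2 = sum_(x, y) (T^n 1)(x) (T^n 1)(y) phi (x y^-1)
    is at most a constant times the squared l^2 norm of the n-step distribution
    of the lazy walk [T], which by Cheeger's inequality decays exponentially at
    a rate depending only on gamma and d; the sequence |T^n f|^2 is log-convex,
    so its first step already contracts at that rate.  Approximation by local,
    resp. clopen, events extends the gap to all events of FIID, resp. weak FIID
    percolations: with kappa = kappa (gamma, d),
      sum_(s ~ 1) P (E /\ s^-1 E) <= d (kappa P(E)^2 + (1 - kappa) P(E)).
    Let [E] be the event that the cluster of the identity has average degree at
    least d (1 - delta) and lies in [A].  The left-hand side is then at least
    E[deg 1_E] >= d (1 - delta) P(E), so P(E) = 0 or kappa (1 - P(E)) <= delta.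
    The same holds with the complement of [A]; the two events are disjoint, so
    one has probability at most 1/2, and it is null when 2 delta < kappa. *)

Set Implicit Arguments.
Unset Strict Implicit.
Unset Printing Implicit Defensive.

Import Order.TTheory GRing.Theory Num.Theory.
Import numFieldNormedType.Exports.

Local Open Scope classical_set_scope.
Local Open Scope fset_scope.
Local Open Scope ring_scope.

(** * The l^2 gap of an expanding Cayley graph *)

Section IsoperimetryGap.
Variables (R : realFieldType) (G : groupType) (N : {fset G}) (gamma : R).
Hypothesis gamma_ge0 : 0 <= gamma.
Hypothesis iso : forall W : {fset G}, gamma * #|` W|%:R <=
  \sum_(x <- W) \sum_(s <- N) ((x * s)%g \notin W)%:R.

Lemma fset_argmin (T : choiceType) (W : {fset T}) (F : T -> R) : W != fset0 ->
  exists2 x, x \in W & forall y, y \in W -> F x <= F y.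
Proof.
case/fset0Pn => x0 x0W.
case: (@arg_minP _ R W [` x0W] predT (fun i => F (val i))) => // i _ im.
by exists (val i) => [|y yW]; [exact: valP|exact: (im [` yW])].
Qed.

(** A discrete co-area inequality, by induction on the size of [W]. The layer of height [m], the
    minimum of [F] on [W], is handled by [iso]; the remainder [F'] vanishes at a minimiser, so its
    support loses a vertex. *)
Lemma layer_cake (F : G -> R) (W : {fset G}) :
  (forall x, 0 <= F x) -> (forall x, x \notin W -> F x = 0) ->
  gamma * \sum_(x <- W) F x <=
  \sum_(x <- W) \sum_(s <- N) Num.max (F x - F (x * s)%g) 0.
Proof.
move: {2}#|`W| (leqnn #|`W|) => n; elim: n W F => [|n IH] W F.
  rewrite leqn0 cardfs_eq0 => /eqP -> _ _.
  by rewrite !big_seq_fset0 mulr0.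
move=> leW F0 FW.
have [->|Wn0] := eqVneq W fset0; first by rewrite !big_seq_fset0 mulr0.
have [x0 x0W minx] := fset_argmin F Wn0.
pose m := F x0.
pose F' x := if x \in W then F x - m else 0.
have F'0 x : 0 <= F' x.
  by rewrite /F'; case: ifPn => // xW; rewrite subr_ge0 minx.
have F'x0 : F' x0 = 0 by rewrite /F' x0W subrr.
have {}IH := IH (W `\ x0) F' _ F'0 _.
have -> : \sum_(x <- W) F x = m * #|`W|%:R + \sum_(x <- W `\ x0) F' x.
  have -> : \sum_(x <- W `\ x0) F' x = \sum_(x <- W) F' x.
    by rewrite [RHS](big_fsetD1 x0)//= F'x0 add0r.
  have -> : m * #|`W|%:R = \sum_(x <- W) m.
    by rewrite big_const_seq count_predT iter_addr_0 mulr_natr.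
  rewrite -big_split/= big_seq [RHS]big_seq; apply: eq_bigr => x xW.
  by rewrite /F' xW addrC subrK.
rewrite mulrDr mulrCA.
(* The splitting is exact: inside [W] the two subtractions of [m] cancel, and an edge leaving [W]
   contributes [F x = m + F' x]. *)
have -> : \sum_(x <- W) \sum_(s <- N) Num.max (F x - F (x * s)%g) 0 =
   m * (\sum_(x <- W) \sum_(s <- N) ((x * s)%g \notin W)%:R) +
   \sum_(x <- W) \sum_(s <- N) Num.max (F' x - F' (x * s)%g) 0.
  rewrite mulr_sumr -big_split/= big_seq [RHS]big_seq; apply: eq_bigr => x xW.
  rewrite mulr_sumr -big_split/=; apply: eq_bigr => s _.
  rewrite {1 2}/F' xW; case: ifPn => xsW /=.
    rewrite mulr0 add0r; congr Num.max; ring.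
  have mx : m <= F x by exact: minx.
  have m0 : 0 <= m by exact: F0.
  rewrite mulr1 !(FW _ xsW) !subr0 !max_l ?subr_ge0 ?F0//; ring.
apply: lerD; first by rewrite ler_wpM2l ?F0// iso.
apply: (le_trans (IH _ _)).
- move: leW; by rewrite (cardfsD1 x0 W) x0W.
- move=> x; rewrite in_fsetD1 negb_and negbK => /orP[/eqP->//|xW].
  by rewrite /F' (negbTE xW).
rewrite [leRHS](big_fsetD1 x0)//= lerDr; apply: sumr_ge0 => s _.
by rewrite le_max lexx orbT.
Qed.

(** Right translation is injective and [F] vanishes off [W], so the nonzero terms on the left are
    values of [F] at distinct points of [W]. *)
Lemma sum_mulr_le (F : G -> R) (W : {fset G}) s :
  (forall x, 0 <= F x) -> (forall x, x \notin W -> F x = 0) ->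
  \sum_(x <- W) F (x * s)%g <= \sum_(x <- W) F x.
Proof.
move=> F0 FW.
rewrite (bigID (fun x => (x * s)%g \in W))/= [X in _ + X]big1 ?addr0; last first.
  by move=> x xW; exact: FW.
have -> : \sum_(x <- W | (x * s)%g \in W) F (x * s)%g =
    \sum_(x <- [fset (x * s)%g | x in W & (x * s)%g \in W]) F x.
  rewrite big_imfset /=; last by move=> x y _ _; exact: mulIg.
  by rewrite -big_filter; apply: perm_big; apply: uniq_perm;
     rewrite ?filter_uniq ?fset_uniq// => x; rewrite mem_filter !inE/= andbC.
rewrite [leRHS](bigID (fun x => x \in [fset (x * s)%g | x in W & (x * s)%g \in W]))/=.
rewrite -[X in _ <= X + _]big_filter.
have -> : \sum_(i <- [seq i <- W | i \in [fset (x * s)%g | x in W & (x * s)%g \in W]]) F i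
  = \sum_(x <- [fset (x * s)%g | x in W & (x * s)%g \in W]) F x.
  apply: perm_big; apply: uniq_perm; rewrite ?filter_uniq ?fset_uniq// => x.
  rewrite mem_filter andbC; apply: andb_idl.
  by case/imfsetP => y /=; rewrite !inE => /andP[_ ysW] ->.
by rewrite lerDl sumr_ge0.
Qed.

(** Cheeger's inequality: [layer_cake] for [f ^+ 2] and AM-GM on [(a - b) * (a + b)] bound the
    Dirichlet sum [D] below by gamma^2 S / (4 d), and expanding [D] turns this into an upper bound
    for the correlation sum [C]. *)
Lemma isoperimetric_gap (f : G -> R) (W : {fset G}) :
  (0 < #|`N|)%N ->
  (forall x, x \notin W -> f x = 0) ->
  \sum_(x <- W) \sum_(s <- N) f x * f (x * s)%g <=
  #|`N|%:R * (1 - gamma ^+ 2 / (8 * #|`N|%:R ^+ 2)) * \sum_(x <- W) f x ^+ 2.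
Proof.
move=> N0 fW; set d : R := #|`N|%:R; set S := \sum_(x <- W) f x ^+ 2.
have d0 : 0 < d by rewrite ltr0n.
set C := (leLHS).
pose D := \sum_(x <- W) \sum_(s <- N) (f x - f (x * s)%g) ^+ 2.
have S0 : 0 <= S by apply: sumr_ge0 => x _; exact: sqr_ge0.
have sumN (a : R) : \sum_(s <- N) a = d * a.
  by rewrite big_const_seq count_predT iter_addr_0 mulr_natl.
have sumS : \sum_(x <- W) \sum_(s <- N) f x ^+ 2 = d * S.
  by rewrite mulr_sumr; apply: eq_bigr => x _; rewrite sumN.
have sumS' : \sum_(x <- W) \sum_(s <- N) f (x * s)%g ^+ 2 <= d * S.
  rewrite exchange_big /= -sumN; apply: ler_sum => s _.
  apply: (@sum_mulr_le (fun x => f x ^+ 2)) => [x|x xW]; first exact: sqr_ge0.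
  by rewrite fW// expr0n.
have DE : D <= 2 * d * S - 2 * C.
  have -> : D = d * S - 2 * C + \sum_(x <- W) \sum_(s <- N) f (x * s)%g ^+ 2.
    rewrite -sumS mulr_sumr -sumrB -big_split; apply: eq_bigr => x _ /=.
    rewrite mulr_sumr -sumrB -big_split; apply: eq_bigr => s _ /=; ring.
  lra.
have cake : gamma * S <=
    \sum_(x <- W) \sum_(s <- N) Num.max (f x ^+ 2 - f (x * s)%g ^+ 2) 0.
  apply: (@layer_cake (fun x => f x ^+ 2)) => [x|x xW]; first exact: sqr_ge0.
  by rewrite fW// expr0n.
(* AM-GM, from [0 <= (4 d (a - b) - gamma (a + b)) ^ 2] *)
have amgm a b : 8 * d * gamma * Num.max (a ^+ 2 - b ^+ 2) 0 <=
    (16 * d ^+ 2) * (a - b) ^+ 2 + (2 * gamma ^+ 2) * (a ^+ 2 + b ^+ 2).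
  have h : 0 <= (4 * d * (a - b) - gamma * (a + b)) ^+ 2 by exact: sqr_ge0.
  have h1 : 0 <= d ^+ 2 * (a - b) ^+ 2 by rewrite mulr_ge0 ?sqr_ge0.
  have h2 : 0 <= gamma ^+ 2 * (a - b) ^+ 2 by rewrite mulr_ge0 ?sqr_ge0.
  have h3 : 0 <= gamma ^+ 2 * (a + b) ^+ 2 by rewrite mulr_ge0 ?sqr_ge0.
  by case: (leP (a ^+ 2 - b ^+ 2) 0) => _; rewrite ?mulr0; nra.
have : 8 * d * gamma * (gamma * S) <=
    16 * d ^+ 2 * D + (2 * gamma ^+ 2) * (2 * d * S).
  apply: (@le_trans _ _ (16 * d ^+ 2 * D + (2 * gamma ^+ 2) *
     (d * S + \sum_(x <- W) \sum_(s <- N) f (x * s)%g ^+ 2))); last first.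
    rewrite lerD2l ler_wpM2l ?mulr_ge0 ?sqr_ge0//; lra.
  apply: (le_trans (ler_wpM2l _ cake)); first by rewrite !mulr_ge0// ltW.
  rewrite -sumS -big_split !mulr_sumr -big_split; apply: ler_sum => x _ /=.
  rewrite -big_split !mulr_sumr -big_split; apply: ler_sum => s _ /=.
  exact: amgm.
move=> h; have {}h : d * (4 * d * D - gamma ^+ 2 * S) >= 0 by nra.
rewrite pmulr_rge0// in h.
have h2 : 8 * d * C <= (8 * d ^+ 2 - gamma ^+ 2) * S.
  have : 4 * d * D <= 4 * d * (2 * d * S - 2 * C).
    by rewrite ler_wpM2l// mulr_ge0// ltW.
  nra.
have -> : d * (1 - gamma ^+ 2 / (8 * d ^+ 2)) * S =
   (8 * d ^+ 2 - gamma ^+ 2) * S / (8 * d).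
  by field; rewrite gt_eqF.
by rewrite ler_pdivlMr ?mulr_gt0// mulrC.
Qed.
End IsoperimetryGap.

(** * Positive definite functions of finite support *)

Section LogConvex.
Variable R : archiRealFieldType.

Lemma expr_unbounded (x y : R) : 1 < x -> exists n, y < x ^+ n.
Proof.
move=> x1; have x10 : 0 < x - 1 by rewrite subr_gt0.
have bern n : 1 + n%:R * (x - 1) <= x ^+ n.
  elim: n => [|n IH]; first by rewrite mul0r addr0 expr0.
  rewrite exprS -natr1; have n0 : 0 <= n%:R :> R by [].
  have : x * (1 + n%:R * (x - 1)) <= x * x ^+ n by rewrite ler_wpM2l//; lra.
  have : 0 <= n%:R * (x - 1) ^+ 2 by rewrite mulr_ge0 ?sqr_ge0.
  nra.
exists (Num.bound `|y / (x - 1)|); apply: lt_le_trans (bern _).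
have := le_lt_trans (ler_norm _) (archi_boundP (normr_ge0 (y / (x - 1)))).
rewrite ltr_pdivrMr//; lra.
Qed.

(** Log-convexity makes the ratios of successive terms nondecreasing. If the first ratio [q]
    exceeded [r], then [b n] would be at least [q ^+ n * b 0], which eventually beats
    [C * r ^+ n]. *)
Lemma log_convex_decay (b : nat -> R) (C r : R) :
  0 <= r -> (forall n, 0 <= b n) ->
  (forall n, b n.+1 ^+ 2 <= b n * b n.+2) ->
  (forall n, b n <= C * r ^+ n) -> b 1%N <= r * b 0%N.
Proof.
move=> r0 b0 bb bC; case: leP => // rb; exfalso.
(* Positivity is carried along with the strict ratio bound, so that the later divisions are
   legitimate. *)
have {}b0 n : 0 < b n /\ r * b n < b n.+1.
  elim: n => [|n [bn rbn]].
    split=> //; rewrite lt_def b0 andbT; apply/eqP => b00.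
    move: (bb 0%N) rb; rewrite b00 mul0r mulr0 => b10.
    suff -> : b 1%N = 0 by rewrite ltxx.
    by apply/eqP; rewrite -sqrf_eq0; apply/eqP/le_anti; rewrite b10 sqr_ge0.
  have bn1 : 0 < b n.+1 by apply: le_lt_trans rbn; rewrite mulr_ge0// ltW.
  split=> //; rewrite -(ltr_pM2l bn); apply: lt_le_trans (bb n).
  by rewrite mulrA [b n * r]mulrC expr2 ltr_pM2r.
pose q := b 1%N / b 0%N.
have qr : r < q by rewrite ltr_pdivlMr ?(b0 0%N).1.
have ratio n : q * b n <= b n.+1.
  elim: n => [|n IH]; first by rewrite divfK// gt_eqF// (b0 0%N).1.
  have [bn _] := b0 n; have [bn1 _] := b0 n.+1.
  rewrite -(ler_pM2l bn); apply: le_trans (bb n).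
  by rewrite mulrA [b n * q]mulrC expr2 ler_pM2r.
have q0 : 0 < q by exact: le_lt_trans qr.
have low n : q ^+ n * b 0%N <= b n.
  elim: n => [|n IH]; first by rewrite expr0 mul1r.
  by rewrite exprS -mulrA; apply: le_trans (ratio n); rewrite ler_pM2l.
(* The comparison below uses powers of [q / r]; for [r = 0] the bound at [n = 1] is already
   contradictory. *)
have [r00|r1] := eqVneq r 0.
  by have := bC 1%N; rewrite r00 expr1 mulr0 leNgt (b0 1%N).1.
have {}r0 : 0 < r by rewrite lt_def r1.
have qr1 : 1 < q / r by rewrite ltr_pdivlMr// mul1r.
have [n hn] := expr_unbounded (C / b 0%N) qr1.
have : q ^+ n * b 0%N <= C * r ^+ n by exact: le_trans (low n) (bC n).
rewrite leNgt => /negP; apply.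
by rewrite expr_div_n ltr_pdivlMr ?exprn_gt0// mulrAC ltr_pdivrMr ?(b0 0%N).1 in hn.
Qed.
End LogConvex.

(** * Convolution forms and random walk operators *)

Section ConvolutionForm.
Variables (R : realFieldType) (G : groupType).
Implicit Types (u v w : seq (R * G)) (phi : G -> R).

(* Lists [u] stand for finitely supported functions on [G]: a pair [(c, x)]
   is the mass [c] at [x], and repeated points add up. *)
Definition form phi u v : R :=
  \sum_(p <- u) \sum_(q <- v) p.1 * q.1 * phi (p.2 * q.2^-1)%g.

(** One step of the random walk: each mass is split evenly over right multiplication by the entries
    of [L]. Repeated entries count with multiplicity, which is how laziness is encoded. *)
Definition walk (L : seq G) u : seq (R * G) :=
  [seq (p.1 / (size L)%:R, (p.2 * s)%g) | p <- u, s <- L].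

Definition mass_rshift (s : G) u := [seq (p.1, (p.2 * s)%g) | p <- u].

Definition positive_definite phi := forall u, 0 <= form phi u u.

Lemma form_catl phi u v w : form phi (u ++ v) w = form phi u w + form phi v w.
Proof. by rewrite /form big_cat. Qed.

Lemma form_sym phi u v : (forall g, phi g^-1%g = phi g) ->
  form phi u v = form phi v u.
Proof.
move=> phiV; rewrite /form exchange_big; apply: eq_bigr => p _.
apply: eq_bigr => q _; rewrite -[in RHS]phiV invgM invgK; ring.
Qed.

Lemma form_scalel phi a u v :
  form phi [seq (a * p.1, p.2) | p <- u] v = a * form phi u v.
Proof.
rewrite /form big_map mulr_sumr; apply: eq_bigr => p _ /=.
by rewrite mulr_sumr; apply: eq_bigr => q _; rewrite !mulrA.
Qed.

Lemma form_walkl phi L u v :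
  form phi (walk L u) v = (\sum_(s <- L) form phi (mass_rshift s u) v) / (size L)%:R.
Proof.
rewrite /form /walk big_allpairs_dep /= mulr_suml.
under eq_bigr => p _.
  under eq_bigr => s _.
    under eq_bigr => q _ do rewrite [_ / _ * _]mulrAC -[_ / _ * _]mulrAC.
    rewrite -mulr_suml; over.
  over.
rewrite exchange_big/=; apply: eq_bigr => s _.
by rewrite big_map mulr_suml.
Qed.

(** A right factor [s] on the first argument of x y^-1 is a right factor [s^-1] on the second, and
    [L] is symmetric. *)
Lemma form_walk_adjoint phi L u v : perm_eq ([seq s^-1%g | s <- L]) L ->
  form phi (walk L u) v = form phi u (walk L v).
Proof.
move=> LV; rewrite /form /walk big_allpairs_dep; apply: eq_bigr => p _ /=.
rewrite big_allpairs_dep exchange_big/=; apply: eq_bigr => q _.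
rewrite -(perm_big _ LV) big_map; apply: eq_bigr => s _.
rewrite invgM mulgA; ring.
Qed.

Lemma form_rshift phi s u v : form phi (mass_rshift s u) (mass_rshift s v) = form phi u v.
Proof.
rewrite /form big_map; apply: eq_bigr => p _; rewrite big_map.
by apply: eq_bigr => q _ /=; rewrite invgM mulgA mulgK.
Qed.

Section Positive.
Variable phi : G -> R.
Hypotheses (phiV : forall g, phi g^-1%g = phi g) (phi0 : positive_definite phi).

Lemma form_lincomb a u v : 0 <= a ^+ 2 * form phi u u
  + 2 * a * form phi u v + form phi v v.
Proof.
have := phi0 ([seq (a * p.1, p.2) | p <- u] ++ v).
rewrite form_catl form_scalel ![form phi _ (_ ++ _)]form_sym// !form_catl.
rewrite ![form phi [seq _ | _ <- _] _]form_scalel (form_sym v u)//; lra.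
Qed.

Lemma form_amgm u v : 2 * form phi u v <= form phi u u + form phi v v.
Proof. by have := form_lincomb (-1) u v; lra. Qed.

Lemma form_amgmN u v : - (2 * form phi u v) <= form phi u u + form phi v v.
Proof. by have := form_lincomb 1 u v; lra. Qed.

Lemma form_CauchySchwarz u v :
  form phi u v ^+ 2 <= form phi u u * form phi v v.
Proof.
have uu := phi0 u; have vv := phi0 v.
have [uu0|uu1] := eqVneq (form phi u u) 0; last first.
  have {}uu : 0 < form phi u u by rewrite lt_def uu1.
  have := form_lincomb (- form phi u v / form phi u u) u v.
  have -> : (- form phi u v / form phi u u) ^+ 2 * form phi u u +
     2 * (- form phi u v / form phi u u) * form phi u v + form phi v v =
     (form phi u u * form phi v v - form phi u v ^+ 2) / form phi u u.
    by field; rewrite gt_eqF.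
  by rewrite pmulr_lge0 ?invr_gt0// subr_ge0.
rewrite uu0 mul0r.
(* For a null vector [u] with [form phi u v] nonzero, this coefficient would give the nonnegative
   quantity the value -1. *)
have := form_lincomb (- (form phi v v + 1) / 2 / form phi u v) u v.
have [->|uv0] := eqVneq (form phi u v) 0; first by rewrite expr0n.
rewrite uu0 mulr0 add0r.
have -> : 2 * (- (form phi v v + 1) / 2 / form phi u v) * form phi u v =
   - (form phi v v + 1) by field.
lra.
Qed.

(** The left-hand side is an average of forms of two right translates of [u]; AM-GM and translation
    invariance bound each by [form phi u u]. *)
Lemma form_walk_contract L u :
  form phi (walk L u) (walk L u) <= form phi u u.
Proof.
have [->|L0] := eqVneq L [::].
  by have -> : walk [::] u = [::] by [elim: (u)]; rewrite {1}/form big_nil.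
have sL : 0 < (size L)%:R :> R by rewrite ltr0n lt0n size_eq0.
rewrite form_walkl ler_pdivrMr//.
have -> : form phi u u * (size L)%:R = \sum_(s <- L) form phi u u.
  by rewrite big_const_seq count_predT iter_addr_0 mulr_natr.
apply: ler_sum => s _; rewrite form_sym// form_walkl ler_pdivrMr//.
have -> : form phi u u * (size L)%:R = \sum_(s <- L) form phi u u.
  by rewrite big_const_seq count_predT iter_addr_0 mulr_natr.
apply: ler_sum => t _.
have := form_amgm (mass_rshift t u) (mass_rshift s u); rewrite !form_rshift; lra.
Qed.
End Positive.
End ConvolutionForm.

(** * From l^2 decay to a gap for positive definite functions *)

Section SpectralGap.
Variables (R : archiRealFieldType) (G : groupType).
Implicit Types (u v w : seq (R * G)) (phi : G -> R).

Definition mass u x : R := \sum_(p <- u | p.2 == x) p.1.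

(** With this kernel, [form] is the l^2 inner product of the functions that the lists represent. *)
Definition point_mass (g : G) : R := (g == 1%g)%:R.

Definition supp u : {fset G} := [fset x | x in map snd u].

Lemma mass0 u x : x \notin supp u -> mass u x = 0.
Proof.
move=> xu; rewrite /mass big1_seq// => p /andP[/eqP px pu].
by move: xu; rewrite !inE/= -px map_f.
Qed.

Lemma sum_mass u (h : G -> R) :
  \sum_(p <- u) p.1 * h p.2 = \sum_(x <- supp u) mass u x * h x.
Proof.
under [RHS]eq_bigr => x _ do rewrite /mass big_mkcond/= mulr_suml.
rewrite exchange_big/= big_seq [RHS]big_seq; apply: eq_bigr => p pu.
rewrite (big_fsetD1 p.2)/=; last by rewrite !inE/= map_f.
rewrite eqxx big1_fset ?addr0// => x.
by rewrite !inE eq_sym => /andP[/negbTE -> _]; rewrite mul0r.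
Qed.

Lemma form_point_massl u v : form point_mass u v = \sum_(p <- u) p.1 * mass v p.2.
Proof.
apply: eq_bigr => p _; rewrite /mass mulr_sumr [RHS]big_mkcond/=.
apply: eq_bigr => q _; rewrite /point_mass mulg_eq1 invgK eq_sym.
by case: eqP; rewrite ?mulr1 ?mulr0.
Qed.

Lemma form_point_mass u v :
  form point_mass u v = \sum_(x <- supp u) mass u x * mass v x.
Proof. by rewrite form_point_massl sum_mass. Qed.

Lemma point_massV g : point_mass g^-1%g = point_mass g.
Proof. by rewrite /point_mass invg_eq1. Qed.

Lemma point_mass_positive : positive_definite point_mass.
Proof.
by move=> u; rewrite form_point_mass sumr_ge0// => x _; rewrite -expr2 sqr_ge0.
Qed.

(** The l^1 norm bounds the convolution norm: [phi] is a combination of point masses, each giving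
    the inner product of [u] with a left translate, and left translation is an l^2 isometry. *)
Lemma form_le_point_mass phi (K : {fset G}) u :
  (forall g, g \notin K -> phi g = 0) ->
  form phi u u <= (\sum_(g <- K) `|phi g|) * form point_mass u u.
Proof.
move=> phiK.
pose lshift g := [seq (p.1, (g^-1 * p.2)%g) | p <- u].
have -> : form phi u u = \sum_(g <- K) phi g * form point_mass (lshift g) u.
  under [RHS]eq_bigr => g _.
    rewrite /form big_map mulr_sumr.
    under eq_bigr => p _ do rewrite mulr_sumr.
    over.
  rewrite exchange_big/=; apply: eq_bigr => p _.
  rewrite exchange_big/=; apply: eq_bigr => q _.
  have pmE g : point_mass (g^-1 * p.2 * q.2^-1) = (g == p.2 * q.2^-1)%g%:R.
    by rewrite /point_mass -mulgA mulg_eq1 (inj_eq invg_inj).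
  under eq_bigr => g _ do rewrite pmE.
  have [pqK|pqK] := boolP ((p.2 * q.2^-1)%g \in K).
    rewrite (big_fsetD1 _ pqK)/= eqxx mulr1 big1_fset ?addr0; first by ring.
    by move=> g; rewrite !inE => /andP[/negbTE -> _]; rewrite !mulr0.
  rewrite phiK// mulr0 big1_fset// => g gK _.
  by case: eqP => [ge|_]; rewrite ?mulr0//; rewrite ge (negbTE pqK) in gK.
rewrite mulr_suml; apply: ler_sum => g _.
(* Left translation conjugates x y^-1, and conjugation fixes only the identity to the identity. *)
have isom : form point_mass (lshift g) (lshift g) = form point_mass u u.
  rewrite /form big_map; apply: eq_bigr => p _; rewrite big_map.
  apply: eq_bigr => q _ /=; congr (_ * _); rewrite /point_mass.
  by rewrite invgM invgK -mulgA [(p.2 * (_ * _))%g]mulgA -conjgE conjg_eq1.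
apply: (le_trans (ler_norm _)); rewrite normrM ler_wpM2l//.
have := form_amgm point_massV point_mass_positive (lshift g) u.
have := form_amgmN point_massV point_mass_positive (lshift g) u.
rewrite isom ler_norml => h1 h2; lra.
Qed.

Variables (N : {fset G}) (gamma : R).
Hypothesis NV : forall s, s \in N -> s^-1%g \in N.
Hypothesis N0 : (0 < #|`N|)%N.
Hypothesis gamma_ge0 : 0 <= gamma.
Hypothesis iso : forall W : {fset G}, gamma * #|` W|%:R <=
  \sum_(x <- W) \sum_(s <- N) ((x * s)%g \notin W)%:R.

(** Cheeger's lower bound for the spectral gap of the simple walk, as in [isoperimetric_gap]. *)
Definition gap : R := gamma ^+ 2 / (8 * #|`N|%:R ^+ 2).

Lemma gap_ge0 : 0 <= gap.
Proof. by apply: divr_ge0; [|apply: mulr_ge0]; rewrite ?sqr_ge0. Qed.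

(** As many copies of the identity as elements of [N]: the walk stays put with probability 1/2. *)
Definition lazy_steps : seq G := nseq #|`N| 1%g ++ N.

Lemma steps_inv : perm_eq [seq s^-1%g | s <- N] N.
Proof.
apply: uniq_perm; rewrite ?map_inj_uniq ?fset_uniq//; first exact: invg_inj.
move=> s; apply/mapP/idP => [[t tN ->]|sN]; first exact: NV.
by exists s^-1%g; rewrite ?invgK// NV.
Qed.

Lemma lazy_steps_inv : perm_eq [seq s^-1%g | s <- lazy_steps] lazy_steps.
Proof. by rewrite map_cat map_nseq invg1 perm_cat2l steps_inv. Qed.

Lemma rshift_one u : mass_rshift 1%g u = u.
Proof. by elim: u => //= -[a x] u ->; rewrite mulg1. Qed.

Lemma form_lazyl phi u v :
  form phi (walk lazy_steps u) v =
  form phi u v / 2 + form phi (walk N u) v / 2.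
Proof.
have d0 : #|`N|%:R != 0 :> R by rewrite pnatr_eq0 -lt0n.
rewrite !form_walkl big_cat/= size_cat size_nseq.
rewrite big_nseq iter_addr_0 rshift_one -mulr_natl natrD; field; rewrite d0/=.
by rewrite -natrD pnatr_eq0 -lt0n addn_gt0 N0.
Qed.

Lemma lazy_gap u :
  form point_mass u (walk lazy_steps u) <= (1 - gap / 2) * form point_mass u u.
Proof.
have d0 : 0 < #|`N|%:R :> R by rewrite ltr0n.
rewrite form_sym; last exact: point_massV.
rewrite form_lazyl.
suff : form point_mass (walk N u) u <= (1 - gap) * form point_mass u u by lra.
rewrite form_walkl ler_pdivrMr// mulrAC.
have := isoperimetric_gap gamma_ge0 iso N0 (@mass0 u).
rewrite (_ : \sum_(x <- supp u) mass u x ^+ 2 = form point_mass u u); last first.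
  by rewrite form_point_mass; apply: eq_bigr => x _; rewrite expr2.
rewrite -/gap [_ * (1 - gap)]mulrC; apply: le_trans.
rewrite [leRHS]exchange_big/=; apply: ler_sum => s _.
rewrite -sum_mass form_point_massl.
by rewrite big_map; apply: ler_sum => p _ /=; rewrite lexx.
Qed.

(** With T = (1 + P) / 2, where P is the simple walk, P^2 <= 1 gives T^2 <= T; hence |T u|^2 is at
    most the inner product of u and T u, which [lazy_gap] controls. *)
Lemma lazy_contract u :
  form point_mass (walk lazy_steps u) (walk lazy_steps u) <=
  (1 - gap / 2) * form point_mass u u.
Proof.
apply: le_trans (lazy_gap u).
have c := form_walk_contract point_massV point_mass_positive N u.
rewrite form_lazyl ![form point_mass _ (walk lazy_steps u)]form_sym;
  [|exact: point_massV..].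
rewrite !form_lazyl (form_sym u (walk N u))//; last exact: point_massV.
lra.
Qed.

(** The decay of the l^2 norm passes to [phi] up to a factor depending on [phi]; log-convexity
    removes that factor and leaves a rate depending only on [gap]. *)
Lemma positive_definite_gap phi (K : {fset G}) :
  gap <= 1 -> (forall g, phi g^-1%g = phi g) -> positive_definite phi ->
  (forall g, g \notin K -> phi g = 0) ->
  \sum_(s <- N) phi s <= #|`N|%:R * (1 - gap / 2) * phi 1%g.
Proof.
move=> gap1 phiV phi0 phiK.
have d0 : 0 < #|`N|%:R :> R by rewrite ltr0n.
have gap0 := gap_ge0.
pose v : seq (R * G) := [:: (1, 1%g)].
pose q n := iter n (walk lazy_steps) v.
pose b n := form phi (q n) (q n).
have vE : form phi v v = phi 1%g.
  by rewrite /form !big_seq1/= !mul1r invg1 mulg1.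
have decay n : form point_mass (q n) (q n) <= (1 - gap / 2) ^+ n.
  elim: n => [|n IH].
    by rewrite /form !big_seq1/= !mul1r invg1 mulg1 /point_mass eqxx.
  rewrite exprS; apply: (le_trans (lazy_contract _)); rewrite ler_wpM2l//; lra.
have b10 : b 1%N <= (1 - gap / 2) * b 0%N.
  apply: (@log_convex_decay _ b (\sum_(g <- K) `|phi g|)).
  - lra.
  - by move=> n; exact: phi0.
  (* Self-adjointness rewrites [b n.+1] as the form of [q n] and [q n.+2], so Cauchy-Schwarz is
     log-convexity. *)
  - move=> n; rewrite {1}/b /= form_walk_adjoint; last exact: lazy_steps_inv.
    exact: form_CauchySchwarz.
  - move=> n; apply: (le_trans (form_le_point_mass _ phiK)).
    by rewrite ler_wpM2l// sumr_ge0.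
have CS := form_CauchySchwarz phiV phi0 (q 1%N) (q 0%N).
rewrite -/(b 0%N) -/(b 1%N) in CS.
have b0E : b 0%N = phi 1%g by exact: vE.
have b00 : 0 <= b 0%N by exact: phi0.
(* Cauchy-Schwarz gives the factor sqrt (1 - gap / 2), which is at most 1 - gap / 4. *)
have : form phi (q 1%N) (q 0%N) <= (1 - gap / 4) * b 0%N.
  have [|/ltW f0] := leP (form phi (q 1%N) (q 0%N)) 0.
    by move=> h; apply: (le_trans h); rewrite mulr_ge0//; lra.
  rewrite -(@ler_pXn2r _ 2)// ?nnegrE//; last by rewrite mulr_ge0//; lra.
  apply: (le_trans CS); apply: (@le_trans _ _ ((1 - gap / 2) * b 0%N * b 0%N)).
    by rewrite ler_wpM2r.
  rewrite exprMn [b 0%N ^+ 2]expr2 -mulrA ler_wpM2r ?mulr_ge0//.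
  have := sqr_ge0 gap; nra.
rewrite /= form_lazyl b0E vE.
have -> : form phi (walk N v) v = (\sum_(s <- N) phi s) / #|`N|%:R.
  rewrite form_walkl; congr (_ / _); apply: eq_bigr => s _.
  by rewrite /form /= !big_seq1/= !mul1r invg1 mulg1 mul1g.
(* Passing from the lazy walk back to the simple one doubles the loss from gap / 4 to gap / 2. *)
move=> h.
have : (\sum_(s <- N) phi s) / #|`N|%:R <= (1 - gap / 2) * phi 1%g by lra.
by rewrite ler_pdivrMr// => h2; apply: (le_trans h2); rewrite mulrC mulrA.
Qed.

End SpectralGap.

(** * Covariances of translated events *)

Section RealProbability.
Local Open Scope classical_set_scope.
Context d (T : measurableType d) (R : realType) (nu : probability T R).
Implicit Types A B : set T.

Definition pr A : R := fine (nu A).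

Lemma prE A : measurable A -> nu A = (pr A)%:E.
Proof. by move=> mA; rewrite /pr fineK// fin_num_measure. Qed.

Lemma pr_ge0 A : 0 <= pr A.
Proof. exact: fine_ge0. Qed.

Lemma pr_le1 A : measurable A -> pr A <= 1.
Proof. by move=> mA; rewrite -lee_fin -prE// probability_le1. Qed.

Lemma pr_setT : pr setT = 1.
Proof. by rewrite /pr probability_setT. Qed.

Lemma le_pr A B : measurable A -> measurable B -> A `<=` B -> pr A <= pr B.
Proof.
by move=> mA mB AB; rewrite -lee_fin -!prE//; apply: le_measure; rewrite ?inE.
Qed.

Lemma pr_setU_le A B : measurable A -> measurable B ->
  pr (A `|` B) <= pr A + pr B.
Proof.
move=> mA mB; rewrite -lee_fin EFinD -!prE//; last exact: measurableU.
exact: measureU2.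
Qed.

Lemma pr_setU A B : measurable A -> measurable B -> A `&` B = set0 ->
  pr (A `|` B) = pr A + pr B.
Proof.
move=> mA mB AB; apply/EFin_inj; rewrite EFinD -!prE//; last exact: measurableU.
exact: measureU.
Qed.

Lemma integral_lincomb (I : Type) (s : seq I) (c : I -> R) (A : I -> set T) :
  (forall i, measurable (A i)) ->
  (\int[nu]_x (\sum_(i <- s) c i * \1_(A i) x)%:E =
   (\sum_(i <- s) c i * pr (A i))%:E)%E.
Proof.
move=> mA.
under eq_integral do rewrite -sumEFin.
rewrite integral_sum//; last first.
  move=> i; have -> : (fun x => (c i * \1_(A i) x)%:E) =
      (fun x => (c i)%:E * (\1_(A i) x)%:E)%E by [].
  by apply: integrableZl => //; exact: integrable_indic.
rewrite -sumEFin; apply: eq_bigr => i _.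
under eq_integral do rewrite EFinM.
rewrite integralZl//; last exact: integrable_indic.
by rewrite integral_indic// setIT EFinM; congr (_ * _)%E; exact: prE.
Qed.

(** The double sum is the integral of the square of a linear combination of indicators. *)
Lemma gram_positive (I : Type) (s : seq I) (c : I -> R) (A : I -> set T) :
  (forall i, measurable (A i)) ->
  0 <= \sum_(i <- s) \sum_(j <- s) c i * c j * pr (A i `&` A j).
Proof.
move=> mA; pose t := [seq (i, j) | i <- s, j <- s].
have -> : \sum_(i <- s) \sum_(j <- s) c i * c j * pr (A i `&` A j) =
    \sum_(ij <- t) (c ij.1 * c ij.2) * pr (A ij.1 `&` A ij.2).
  by rewrite big_allpairs_dep.
rewrite -lee_fin -integral_lincomb; last by move=> ij; exact: measurableI.
apply: integral_ge0 => x _; rewrite lee_fin big_allpairs_dep/=.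
have -> : \sum_(i <- s) \sum_(j <- s) c i * c j * \1_(A i `&` A j) x =
    (\sum_(i <- s) c i * \1_(A i) x) ^+ 2 :> R.
  rewrite expr2 mulr_suml; apply: eq_bigr => i _.
  rewrite mulr_sumr; apply: eq_bigr => j _.
  by rewrite indicI/= mulrACA.
exact: sqr_ge0.
Qed.

(** Adding the whole space with coefficient [- m], where [m] is the mean of the combination, centres
    it and reduces to [gram_positive]. *)
Lemma covariance_positive (I : Type) (s : seq I) (c : I -> R)
    (A : I -> set T) : (forall i, measurable (A i)) ->
  0 <= \sum_(i <- s) \sum_(j <- s)
         c i * c j * (pr (A i `&` A j) - pr (A i) * pr (A j)).
Proof.
move=> mA; pose m := \sum_(i <- s) c i * pr (A i).
pose c' o := if o is Some i then c i else - m.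
pose A' o := if o is Some i then A i else setT.
have := @gram_positive _ (None :: [seq Some i | i <- s]) c' A' _.
rewrite big_cons !big_map big_cons big_map/= setTI pr_setT.
under eq_bigr => i _ do rewrite setTI -mulrA.
rewrite -mulr_sumr -/m.
under [X in _ + X]eq_bigr => i _.
  rewrite big_cons big_map/= setIT mulrAC.
  over.
rewrite big_split/= -mulr_suml -/m.
have -> : \sum_(i <- s) \sum_(j <- s)
    c i * c j * (pr (A i `&` A j) - pr (A i) * pr (A j)) =
    \sum_(i <- s) \sum_(j <- s) c i * c j * pr (A i `&` A j) - m * m.
  rewrite /m mulr_suml -sumrB; apply: eq_bigr => i _.
  by rewrite mulr_sumr -sumrB; apply: eq_bigr => j _; ring.
move=> h; have /h : forall o, measurable (A' o).
  by case=> [i|]; [exact: mA|exact: measurableT].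
lra.
Qed.

End RealProbability.

(** * The gap inequality for events under a measure-preserving action *)

Section EventGap.
Local Open Scope classical_set_scope.
Context d (T : measurableType d) (R : realType) (nu : probability T R).
Variables (G : groupType) (tau : G -> T -> T).
Hypothesis tau_measurable : forall g, measurable_fun setT (tau g).
Hypothesis tau1 : forall t, tau 1%g t = t.
Hypothesis tauM : forall g h t, tau (g * h)%g t = tau g (tau h t).
Hypothesis tau_nu : forall g B, measurable B -> nu (tau g @^-1` B) = nu B.
Local Notation p := (pr nu).

Lemma measurable_tau g B : measurable B -> measurable (tau g @^-1` B).
Proof. by move=> mB; rewrite -[X in measurable X]setTI; exact: tau_measurable. Qed.

Lemma pr_tau g B : measurable B -> p (tau g @^-1` B) = p B.
Proof. by move=> mB; rewrite /pr tau_nu. Qed.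

(** After subtracting [p E ^+ 2] from each term, this says that the covariances of [E] with its
    translates by [N] average to at most [1 - kappa] times the variance of its indicator. *)
Definition event_gap (N : {fset G}) (kappa : R) (E : set T) :=
  \sum_(s <- N) p (E `&` tau s @^-1` E) <=
  #|`N|%:R * (kappa * p E ^+ 2 + (1 - kappa) * p E).

Lemma correlation_shift x y E : measurable E ->
  p (E `&` tau (x * y^-1)%g @^-1` E) = p (tau x @^-1` E `&` tau y @^-1` E).
Proof.
move=> mE; rewrite -(@pr_tau y); last by apply: measurableI => //; exact: measurable_tau.
congr p; rewrite preimage_setI setIC; congr (_ `&` _).
by apply/seteqP; split=> t /=; rewrite -tauM mulgVK.
Qed.

Section Local.
Local Open Scope classical_set_scope.
Variables (N : {fset G}) (gamma : R).
Hypothesis NV : forall s, s \in N -> s^-1%g \in N.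
Hypothesis N0 : (0 < #|`N|)%N.
Hypothesis gamma_ge0 : 0 <= gamma.
Hypothesis iso : forall W : {fset G}, gamma * #|` W|%:R <=
  \sum_(x <- W) \sum_(s <- N) ((x * s)%g \notin W)%:R.
Hypothesis gap_le1 : gap N gamma <= 1.

(** [positive_definite_gap] is applied to the covariance [phi], supported in [K] by hypothesis,
    whose value at the identity is the variance of the indicator of [E]. *)
Lemma event_gap_local (E : set T) (K : {fset G}) : measurable E ->
  (forall g, g \notin K -> p (E `&` tau g @^-1` E) = p E ^+ 2) ->
  event_gap N (gap N gamma / 2) E.
Proof.
move=> mE EK.
pose phi g := p (E `&` tau g @^-1` E) - p E ^+ 2.
have phiV g : phi g^-1%g = phi g.
  by rewrite /phi -[g^-1%g]mul1g correlation_shift// setIC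
     -correlation_shift// invg1 mulg1.
have phi0 : positive_definite phi.
  move=> u; have := @covariance_positive _ _ _ nu _ u fst
    (fun q => tau q.2 @^-1` E) (fun q => measurable_tau q.2 mE).
  rewrite /form /phi.
  under eq_bigr => q _ do under eq_bigr => q' _ do
    rewrite !pr_tau// -correlation_shift// -expr2.
  by [].
have phiK g : g \notin K -> phi g = 0 by move=> gK; rewrite /phi EK// subrr.
have := positive_definite_gap NV N0 gamma_ge0 iso gap_le1 phiV phi0 phiK.
rewrite /phi sumrB big_const_seq count_predT iter_addr_0 -mulr_natl.
have -> : p (E `&` tau 1%g @^-1` E) = p E.
  by congr p; apply/seteqP; split=> t /=; rewrite tau1; [case|].
rewrite /event_gap; set n := #|`N|%:R; set S := \sum_(_ <- _) _; lra.
Qed.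
End Local.

(** Both sides of the inequality are Lipschitz in the event for the measure of the symmetric
    difference. *)
Lemma event_gap_approx (N : {fset G}) (kappa : R) (E : set T) :
  0 <= kappa <= 1 -> measurable E ->
  (forall eps, 0 < eps -> exists E', [/\ measurable E', event_gap N kappa E'
     & p (E `+` E') <= eps]) ->
  event_gap N kappa E.
Proof.
move=> /andP[k0 k1] mE approx; rewrite /event_gap.
set n : R := #|`N|%:R; have n0 : 0 <= n by [].
apply/ler_addgt0Pr => e e0.
(* Replacing [E] by [E'] costs at most [2 * eps] per element of [N] on each side; the added 1 keeps
   the denominator positive. *)
pose eps := e / (4 * n + 1).
have eps0 : 0 < eps by rewrite divr_gt0// ltr_wpDl// mulr_ge0.
have [E' [mE' gE' EE']] := approx _ eps0.
have mS : measurable (E `+` E') by apply: measurableU; exact: measurableD.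
have sub1 : E `<=` E' `|` (E `+` E').
  by move=> t Et /=; case: (pselect (E' t)) => ?; [left|right; left].
have sub2 : E' `<=` E `|` (E `+` E').
  by move=> t Et /=; case: (pselect (E t)) => ?; [left|right; right].
have le1 : p E <= p E' + eps.
  apply: (le_trans (le_pr _ _ _ sub1)) => //; first exact: measurableU.
  by apply: (le_trans (pr_setU_le _ _ _)) => //; rewrite lerD2l.
have le2 : p E' <= p E + eps.
  apply: (le_trans (le_pr _ _ _ sub2)) => //; first exact: measurableU.
  by apply: (le_trans (pr_setU_le _ _ _)) => //; rewrite lerD2l.
have leS s : p (E `&` tau s @^-1` E) <= p (E' `&` tau s @^-1` E') + 2 * eps.
  have mA : measurable (E' `&` tau s @^-1` E').
    by apply: measurableI => //; exact: measurable_tau.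
  have mB : measurable ((E `+` E') `|` tau s @^-1` (E `+` E')).
    by apply: measurableU => //; exact: measurable_tau.
  apply: (@le_trans _ _ (p ((E' `&` tau s @^-1` E') `|`
     ((E `+` E') `|` tau s @^-1` (E `+` E'))))).
    apply: le_pr; [|exact: measurableU|].
      by apply: measurableI => //; exact: measurable_tau.
    move=> t [/= Et Est].
    case: (pselect (E' t)) => E't; last by right; left; left.
    case: (pselect (E' (tau s t))) => E'st; first by left.
    by right; right; left.
  apply: (le_trans (pr_setU_le _ _ _)) => //; rewrite lerD2l.
  apply: (le_trans (pr_setU_le _ _ _)) => //; first exact: measurable_tau.
  by rewrite pr_tau// mulr_natl mulr2n lerD.
have p0 := pr_ge0 nu E; have p'0 := pr_ge0 nu E'.
have p1 : p E <= 1 by exact: pr_le1.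
have p'1 : p E' <= 1 by exact: pr_le1.
have sq : p E' ^+ 2 <= p E ^+ 2 + 2 * eps.
  have : (p E' - p E) * (p E' + p E) <= eps * 2.
    have [h|/ltW h] := leP (p E' - p E) 0.
      by apply: (@le_trans _ _ 0); rewrite ?mulr_le0_ge0//; lra.
    by apply: ler_pM => //; lra.
  by rewrite !expr2; lra.
apply: (@le_trans _ _ (\sum_(s <- N) (p (E' `&` tau s @^-1` E') + 2 * eps))).
  by apply: ler_sum => s _; exact: leS.
rewrite big_split/= big_const_seq count_predT iter_addr_0 -mulr_natl -/n.
have : n * (kappa * p E' ^+ 2 + (1 - kappa) * p E') <=
       n * (kappa * p E ^+ 2 + (1 - kappa) * p E + 2 * eps).
  rewrite ler_wpM2l//.
  have : kappa * p E' ^+ 2 <= kappa * (p E ^+ 2 + 2 * eps) by rewrite ler_wpM2l.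
  have : (1 - kappa) * p E' <= (1 - kappa) * (p E + eps).
    by rewrite ler_wpM2l//; lra.
  have : 0 <= (1 - kappa) * eps by rewrite mulr_ge0//; lra.
  lra.
have : (4 * n + 1) * eps = e by rewrite mulrC divfK// gt_eqF// ltr_wpDl// mulr_ge0.
move: gE'; rewrite /event_gap -/n; set S := \sum_(_ <- _) _; lra.
Qed.

End EventGap.

(** * Approximation of measurable sets *)

Section Approximation.
Local Open Scope classical_set_scope.
Context d (T : measurableType d) (R : realType) (nu : probability T R).
Variable A : set (set T).
Hypothesis A_measurable : A `<=` measurable.
Hypothesis A0 : A set0.
Hypothesis AC : forall E, A E -> A (~` E).
Hypothesis AU : forall E F, A E -> A F -> A (E `|` F).
Local Notation p := (pr nu).

Definition approximable E := measurable E /\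
  forall eps, 0 < eps -> exists2 E', A E' & p (E `+` E') <= eps.

Lemma measurable_setY (E F : set T) : measurable E -> measurable F ->
  measurable (E `+` F).
Proof. by move=> mE mF; apply: measurableU; exact: measurableD. Qed.

Lemma approximableU E F : approximable E -> approximable F ->
  approximable (E `|` F).
Proof.
move=> [mE aE] [mF aF]; split; first exact: measurableU.
move=> eps e0; have e20 : 0 < eps / 2 by rewrite divr_gt0.
have [E' AE' pE] := aE _ e20; have [F' AF' pF] := aF _ e20.
exists (E' `|` F'); first exact: AU.
have mE' := A_measurable AE'; have mF' := A_measurable AF'.
apply: (@le_trans _ _ (p ((E `+` E') `|` (F `+` F')))).
  apply: le_pr.
  - by apply: measurable_setY; exact: measurableU.
  - by apply: measurableU; exact: measurable_setY.
  - by move=> t /=; tauto.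
apply: (le_trans (pr_setU_le _ _ _)); [exact: measurable_setY..|].
by rewrite [eps]splitr lerD.
Qed.

Lemma approximable_lim E : measurable E ->
  (forall eps, 0 < eps -> exists2 E', approximable E' & p (E `+` E') <= eps) ->
  approximable E.
Proof.
move=> mE aE; split=> // eps e0; have e20 : 0 < eps / 2 by rewrite divr_gt0.
have [F [mF aF] pE] := aE _ e20; have [E' AE' pF] := aF _ e20.
exists E' => //; have mE' := A_measurable AE'.
apply: (@le_trans _ _ (p ((E `+` F) `|` (F `+` E')))).
  apply: le_pr; [exact: measurable_setY| |move=> t /=; case: (pselect (F t)); tauto].
  by apply: measurableU; exact: measurable_setY.
apply: (le_trans (pr_setU_le _ _ _)); [exact: measurable_setY..|].
by rewrite [eps]splitr lerD.
Qed.

(** For a countable union, the finite unions [H n] are approximable and their probabilities increase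
    to that of the whole, so [approximable_lim] applies. *)
Lemma approximable_sigma_algebra : sigma_algebra setT approximable.
Proof.
split.
- split=> // eps e0; exists set0 => //.
  by rewrite /setY setDv setU0 /pr measure0/= ltW.
- move=> E [mE aE]; rewrite setTD; split; first exact: measurableC.
  move=> eps /aE[E' AE' pE]; exists (~` E'); first exact: AC.
  rewrite (_ : _ `+` _ = E `+` E')//.
  by apply/seteqP; split=> t /=; case: (pselect (E t)); case: (pselect (E' t)); tauto.
- move=> F aF; have mF n : measurable (F n) by have [] := aF n.
  pose H n := \big[setU/set0]_(k < n) F k.
  have aH n : approximable (H n).
    elim: n => [|n IH]; rewrite /H ?big_ord0 ?big_ord_recr/=; last first.
      by apply: approximableU => //; exact: aF.
    split=> // eps e0; exists set0 => //.
    by rewrite /setY setDv setU0 /pr measure0/= ltW.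
  have mU : measurable (\bigcup_n F n) by exact: bigcup_measurable.
  have UH : \bigcup_n H n = \bigcup_n F n.
    apply/seteqP; split=> t [n _].
      by rewrite /H -bigcup_mkord => -[k _ Fk]; exists k.
    move=> Fn; exists n.+1 => //; rewrite /H -bigcup_mkord.
    by exists n => /=.
  apply: approximable_lim => // eps e0.
  have cv : p (H n) @[n --> \oo] --> p (\bigcup_n F n).
    apply: fine_cvg; rewrite fineK ?fin_num_measure// -UH.
    apply: nondecreasing_cvg_mu; rewrite ?UH//.
      by move=> n; have [] := aH n.
    by move=> m n mn; exact/subsetPset/subset_bigsetU.
  have [n _ /(_ n (leqnn n)) hn] : \forall n \near \oo,
      `|p (\bigcup_n F n) - p (H n)| < eps.
    by move/cvgr_dist_lt: cv; exact.
  exists (H n) => //; have [mH _] := aH n.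
  have HU : H n `<=` \bigcup_n F n by rewrite -UH => t Ht; exists n.
  rewrite (_ : _ `+` _ = \bigcup_n F n `\` H n); last first.
    have HU0 : H n `\` \bigcup_n F n = set0 by rewrite setD_eq0.
    by rewrite /setY HU0 setU0.
  have -> : p (\bigcup_n F n `\` H n) = p (\bigcup_n F n) - p (H n).
    rewrite -{2}(setDUK HU) pr_setU//; last by rewrite setDIK.
      by rewrite [_ + p (_ `\` _)]addrC addrK.
    exact: measurableD.
  by apply: ltW; apply: le_lt_trans hn; exact: ler_norm.
Qed.

Lemma approximable_generated (GG : set (set T)) : GG `<=` approximable ->
  <<s GG >> `<=` approximable.
Proof. by move=> h; apply: smallest_sub => //; exact: approximable_sigma_algebra. Qed.

End Approximation.

(** * I.i.d. labels *)

Section Labels.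
Local Open Scope classical_set_scope.
Variables (R : realType) (I : choiceType).
Implicit Types (J : {fset I}) (B : I -> set R) (u : labelling I R).

Definition cylinder J B : set (labelling I R) := [set u | forall i, i \in J -> B i (u i)].

Definition cylinders J : set (set (labelling I R)) :=
  [set E | exists2 B, (forall i, measurable (B i)) & E = cylinder J B].

(** The events that depend measurably on finitely many labels. *)
Definition local_events : set (set (labelling I R)) :=
  [set E | exists J, <<s cylinders J >> E].

Lemma measurable_label i (B : set R) : measurable B ->
  measurable [set u : labelling I R | B (u i)].
Proof.
move=> mB; apply: sub_sigma_algebra; exists i => //; exists B => //.
by rewrite setTI.
Qed.

Lemma measurable_cylinder J B : (forall i, measurable (B i)) ->
  measurable (cylinder J B).
Proof.
move=> mB; have -> : cylinder J B =
    \big[setI/setT]_(i <- J) [set u | B i (u i)].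
  by rewrite -bigcap_seq.
by apply: bigsetI_measurable => i _; exact: measurable_label.
Qed.

Lemma cylinders_measurable J : cylinders J `<=` measurable.
Proof. by move=> _ [B mB ->]; exact: measurable_cylinder. Qed.

Lemma local_measurable J : <<s cylinders J >> `<=` measurable.
Proof.
apply: smallest_sub; first exact: sigma_algebra_measurable.
exact: cylinders_measurable.
Qed.

Lemma cylinder_widen J J' B : (J `<=` J')%fset ->
  cylinder J B = cylinder J' (fun i => if i \in J then B i else setT).
Proof.
move=> /fsubsetP JJ'; apply/seteqP; split=> u /= h i iJ.
  by case: ifPn => // /h.
by have := h i (JJ' _ iJ); rewrite iJ.
Qed.

Lemma local_widen J J' : (J `<=` J')%fset -> <<s cylinders J >> `<=` <<s cylinders J' >>.
Proof.
move=> JJ'; apply: smallest_sub; first exact: smallest_sigma_algebra.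
move=> _ [B mB ->]; apply: sub_sigma_algebra; rewrite (cylinder_widen _ JJ').
by exists (fun i => if i \in J then B i else setT) => // i; case: ifP.
Qed.

Lemma cylindersI J : setI_closed (cylinders J).
Proof.
move=> _ _ [B mB ->] [B' mB' ->]; exists (fun i => B i `&` B' i).
  by move=> i; exact: measurableI.
apply/seteqP; split=> u /= => [[h h'] i iJ|h].
  by split; [exact: h|exact: h'].
by split=> i /h[].
Qed.

Lemma cylindersT J : cylinders J setT.
Proof. by exists (fun=> setT) => //; apply/seteqP; split. Qed.

Lemma measurable_labelling (d : measure_display) (T : measurableType d)
  (f : T -> labelling I R) :
  (forall i, measurable_fun setT (fun t => f t i)) -> measurable_fun setT f.
Proof.
move=> mf.
apply: (@measurability _ _ T (labelling I R) setT f
  (\bigcup_i preimage_set_system setT (fun u : labelling I R => u i) measurable)).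
  by [].
move=> _ [_ [i _ [B mB <-]] <-].
by rewrite !setTI; have := mf i measurableT _ mB; rewrite setTI.
Qed.

Variables (nu : probability (labelling I R) R) (m : set R -> R).
Hypothesis nu_cylinder : forall J B, (forall i, measurable (B i)) ->
  pr nu (cylinder J B) = \prod_(i <- J) m (B i).
Local Notation p := (pr nu).

Lemma independent_cylinders J J' B B' : [disjoint J & J']%fset ->
  (forall i, measurable (B i)) -> (forall i, measurable (B' i)) ->
  p (cylinder J B `&` cylinder J' B') = p (cylinder J B) * p (cylinder J' B').
Proof.
move=> JJ' mB mB'; pose B2 i := if i \in J then B i else B' i.
have J'J i : i \in J' -> i \notin J.
  by move=> iJ'; apply/negP => /(fdisjointP JJ'); rewrite iJ'.
have -> : cylinder J B `&` cylinder J' B' = cylinder (J `|` J')%fset B2.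
  apply/seteqP; split=> u /= => [[h h'] i|h].
    by rewrite /B2 inE; case: ifPn => [/h//|_ /= /h'].
  split=> i iJ; have := h i; rewrite /B2 inE iJ ?orbT => /(_ isT)//.
  by rewrite (negbTE (J'J _ iJ)).
rewrite !nu_cylinder//; last by move=> i; rewrite /B2; case: ifP.
have -> : \prod_(i <- (J `|` J')%fset) m (B2 i) = \prod_(i <- J ++ J') m (B2 i).
  apply: perm_big; apply: uniq_perm; rewrite ?fset_uniq//.
    rewrite cat_uniq !fset_uniq/= andbT; apply/hasPn => i; exact: J'J.
  by move=> i; rewrite inE mem_cat.
rewrite big_cat/=; congr (_ * _); apply: eq_big_seq => i iJ; rewrite /B2 ?iJ//.
by rewrite (negbTE (J'J _ iJ)).
Qed.

(** Uniqueness of measures: the restriction of [nu] to [F] and the multiple of [nu] by [p F] are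
    finite and agree on the cylinders over [J], which are closed under intersection. *)
Lemma independent_generated J E F : <<s cylinders J >> E -> measurable F ->
  (forall C, cylinders J C -> p (C `&` F) = p C * p F) ->
  p (E `&` F) = p E * p F.
Proof.
move=> sE mF CF; pose m1 := mrestr nu mF.
pose m2 := mscale (NngNum (pr_ge0 nu F)) nu.
have m12 C : cylinders J C -> m1 C = m2 C.
  move=> cC; have mC := cylinders_measurable cC.
  rewrite /m1 /m2 /mrestr /mscale/= !prE//; last exact: measurableI.
  by rewrite -EFinM CF// mulrC.
have : m1 E = m2 E.
  apply: (@g_sigma_algebra_measure_unique _ R (labelling I R) (cylinders J) _
    (fun=> setT) _ _ m1 m2) => //.
  - exact: cylinders_measurable.
  - by move=> _; exact: cylindersT.
  - exact: bigcup_const.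
  - exact: cylindersI.
  - by move=> _; change (nu (setT `&` F) < +oo)%E; rewrite setTI prE// ltry.
have mE := local_measurable sE.
rewrite /m1 /m2 /mrestr /mscale/= !prE//; last exact: measurableI.
by rewrite -EFinM => -[->]; rewrite mulrC.
Qed.

(** Cylinders are replaced by generated events in one argument at a time. *)
Lemma independent_local J J' E E' : [disjoint J & J']%fset ->
  <<s cylinders J >> E -> <<s cylinders J' >> E' -> p (E `&` E') = p E * p E'.
Proof.
move=> JJ' sE sE'; apply: (independent_generated sE (local_measurable sE')).
move=> _ [B mB ->]; rewrite setIC mulrC.
apply: (independent_generated sE'); first exact: measurable_cylinder.
move=> _ [B' mB' ->]; rewrite setIC mulrC.
exact: independent_cylinders.
Qed.

Lemma measurable_approximable E : measurable E -> approximable nu local_events E.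
Proof.
apply: approximable_generated.
- by move=> F [J]; exact: local_measurable.
- by exists fset0; exact: sigma_algebra0.
- move=> F [J sF]; exists J; exact: sigma_algebraC.
- move=> F F' [J sF] [J' sF']; exists (J `|` J')%fset.
  rewrite -bigcup2E; apply: sigma_algebra_bigcup => -[|[|n]]/=.
  + by apply: local_widen sF; exact: fsubsetUl.
  + by apply: local_widen sF'; exact: fsubsetUr.
  + exact: sigma_algebra0.
- move=> _ [i _ [B mB <-]]; split.
    by rewrite setTI; exact: measurable_label.
  move=> eps e0; exists (setT `&` (fun u => u i) @^-1` B); last first.
    by rewrite /setY setDv setU0 /pr measure0/= ltW.
  exists [fset i]%fset; apply: sub_sigma_algebra; exists (fun=> B) => //.
  rewrite setTI; apply/seteqP; split=> u /= => [Bu j|]; last by apply; rewrite inE.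
  by rewrite inE => /eqP ->.
Qed.

Variables (G : groupType) (act : G -> I -> I).
Hypothesis act1 : forall i, act 1%g i = i.
Hypothesis actM : forall g h i, act (g * h)%g i = act g (act h i).

Definition shift_labels (g : G) u : labelling I R := fun i => u (act g^-1%g i).

Lemma shift_labels1 u : shift_labels 1%g u = u.
Proof. by apply/funext => i; rewrite /shift_labels invg1 act1. Qed.

Lemma shift_labelsM g h u : shift_labels (g * h)%g u = shift_labels g (shift_labels h u).
Proof. by apply/funext => i; rewrite /shift_labels invgM actM. Qed.

Lemma measurable_shift g : measurable_fun setT (shift_labels g).
Proof.
apply: measurable_labelling => i _ B mB; rewrite setTI.
exact: measurable_label.
Qed.

Lemma actVK g : cancel (act g^-1%g) (act g).
Proof. by move=> i; rewrite -actM mulgV act1. Qed.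

Lemma shift_cylinder g J B : shift_labels g @^-1` cylinder J B =
  cylinder [fset act g^-1%g i | i in J]%fset (B \o act g).
Proof.
apply/seteqP; split=> u /= h i.
  by case/imfsetP => j /= jJ ->; rewrite actVK; exact: h.
by move=> iJ; have := h (act g^-1%g i); rewrite /= actVK; apply; apply: in_imfset.
Qed.

(** A shift only relabels the coordinates of a cylinder, which leaves the product formula unchanged;
    the cylinders over all finite sets form a generating pi-system. *)
Lemma shift_nu g (E : set (labelling I R)) : measurable E ->
  nu (shift_labels g @^-1` E) = nu E.
Proof.
pose C := [set E | exists J, cylinders J E].
have shift_meas := measurable_shift g.
move=> mE.
have mm (F : set (labelling I R)) : measurable F = <<s C >> F.
  apply/propext; split; last first.
    apply: smallest_sub; first exact: sigma_algebra_measurable.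
    by move=> D [J]; exact: cylinders_measurable.
  move: F; apply: smallest_sub; first exact: smallest_sigma_algebra.
  move=> _ [i _ [D mD <-]]; apply: sub_sigma_algebra; exists [fset i]%fset.
  exists (fun=> D) => //; rewrite setTI.
  apply/seteqP; split=> u /= => [Du j|]; last by apply; rewrite inE.
  by rewrite inE => /eqP ->.
apply: (@measure_unique _ R (labelling I R) C (fun=> setT) _ _ _ _
  (pushforward nu (shift_labels g)) nu) => //.
- by apply/funext => F; exact: mm.
- move=> _ _ [J [D mD ->]] [J' [D' mD' ->]].
  exists (J `|` J')%fset; rewrite (cylinder_widen D (fsubsetUl J J')).
  rewrite (cylinder_widen D' (fsubsetUr J J')); apply: cylindersI.
    by exists (fun i => if i \in J then D i else setT) => // i; case: ifP.
  by exists (fun i => if i \in J' then D' i else setT) => // i; case: ifP.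
- by move=> _; exists fset0; exact: cylindersT.
- exact: bigcup_const.
- move=> _ [J [D mD ->]].
  change (nu (shift_labels g @^-1` cylinder J D) = nu (cylinder J D)).
  rewrite shift_cylinder !prE; [|exact: measurable_cylinder..|].
    rewrite !nu_cylinder//; last by move=> i; exact: mD.
    rewrite big_imfset/=; last by move=> i j _ _; exact: (can_inj (actVK g)).
    by congr EFin; apply: eq_bigr => i _; rewrite actVK.
  by apply: measurable_cylinder => i; exact: mD.
- by move=> _; change (nu (shift_labels g @^-1` setT) < +oo)%E; rewrite preimage_setT prE// ltry.
Qed.

Lemma shift_local g J E : <<s cylinders J >> E ->
  <<s cylinders [fset act g^-1%g i | i in J]%fset >> (shift_labels g @^-1` E).
Proof.
pose H := [set E | <<s cylinders [fset act g^-1%g i | i in J]%fset >> (shift_labels g @^-1` E)].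
apply: (@smallest_sub _ _ _ H).
  split; rewrite /H/=.
  - by rewrite preimage_set0; exact: sigma_algebra0.
  - by move=> A sA; rewrite setTD preimage_setC; exact: sigma_algebraC.
  - by move=> A sA; rewrite preimage_bigcup; exact: sigma_algebra_bigcup.
move=> _ [B mB ->]; rewrite /H/= shift_cylinder; apply: sub_sigma_algebra.
by exists (B \o act g) => // i; exact: mB.
Qed.

Variables (N : {fset G}) (gamma : R).
Hypothesis act_proper : forall i j, exists K : {fset G}, forall g, act g i = j -> g \in K.
Hypothesis NV : forall s, s \in N -> s^-1%g \in N.
Hypothesis N0 : (0 < #|`N|)%N.
Hypothesis gamma_ge0 : 0 <= gamma.
Hypothesis iso : forall W : {fset G}, gamma * #|` W|%:R <=
  \sum_(x <- W) \sum_(s <- N) ((x * s)%g \notin W)%:R.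
Hypothesis gap_le1 : gap N gamma <= 1.

(** A local event is independent of all but finitely many of its translates because the action on
    labels is proper, so [event_gap_local] applies; general events follow by approximation. *)
Lemma labels_gap E : measurable E ->
  event_gap nu shift_labels N (gap N gamma / 2) E.
Proof.
move=> mE; have gap0 := gap_ge0 N gamma.
apply: (event_gap_approx measurable_shift shift_nu) => //.
  move: gap0 gap_le1; set k := gap N gamma => k0 k1.
  by apply/andP; split; [rewrite divr_ge0|rewrite ler_pdivrMr// mul1r (le_trans k1)// ler1n].
have [_ aE] := measurable_approximable mE.
move=> eps /aE[F [J sF] EF]; exists F; split=> //.
  exact: local_measurable sF.
have [K KP] := choice (fun ij : I * I => act_proper ij.1 ij.2).
(* [KJ] contains every [g] that maps some element of [J] into [J]; for the others, [J] and its
   translate are disjoint. *)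
pose KJ := (\bigcup_(ij <- [seq (i, j) | i <- J, j <- J]) K ij)%fset.
apply: (event_gap_local measurable_shift shift_labels1 shift_labelsM shift_nu NV N0
  gamma_ge0 iso gap_le1 (K := KJ)).
  exact: local_measurable sF.
move=> g gK; rewrite expr2.
have -> : p F * p F = p F * p (shift_labels g @^-1` F).
  by rewrite (pr_tau shift_nu)//; exact: local_measurable sF.
apply: (independent_local _ sF (shift_local sF)).
apply/fdisjointP => i iJ; apply/negP => /imfsetP[j /= jJ ij].
move/negP: gK; apply; apply/bigfcupP; exists (i, j).
  by rewrite andbT; apply/allpairsP; exists (i, j).
by apply: KP; rewrite /= ij actVK.
Qed.

End Labels.

(** * Configurations *)

Section ConfigTopology.
Local Open Scope classical_set_scope.
Variable G : groupType.
Implicit Types (x y : config G) (J K : {fset G}) (E : set (config G)).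

Definition agree J x y := forall v, v \in J -> y v = x v.

(** The sets containing all configurations that agree with [x] on some finite set form a filter
    converging to [x]; conversely, such agreement is a finite intersection of coordinate
    neighbourhoods. *)
Lemma open_agreeP E :
  open E <-> forall x, E x -> exists J, forall y, agree J x y -> E y.
Proof.
split=> [oE x Ex|agE].
  pose F : set_system (config G) :=
    [set A | exists J, forall y, agree J x y -> A y].
  have FF : Filter F.
    split.
    - by exists fset0.
    - move=> A B [J JA] [J' JB]; exists (J `|` J')%fset => y ag; split.
        by apply: JA => v vJ; apply: ag; rewrite inE vJ.
      by apply: JB => v vJ; apply: ag; rewrite inE vJ orbT.
    - by move=> A B AB [J JA]; exists J => y /JA; exact: AB.
  have Fx : F --> x.
    apply/cvg_sup => i A; rewrite nbhsE => -[B [ [V oV VB] Bx] BA].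
    exists [fset i]%fset => y ag; apply: BA; rewrite -VB /= ag ?inE//.
    by move: Bx; rewrite -VB.
  have : nbhs x E by exact: open_nbhs_nbhs.
  by move/Fx.
rewrite openE => x Ex; have [J JE] := agE x Ex.
have : nbhs x (\bigcap_(v in [set` J]) [set y : config G | y v = x v]).
  apply: filter_bigI => v vJ; have cv := @proj_continuous G (fun=> bool) v x.
  have /cv : nbhs (proj v x : bool) [set x v] by
    apply: open_nbhs_nbhs; split=> //; exact: discrete_open.
  by [].
by apply: filterS => y ag; apply: JE => v vJ; exact: ag.
Qed.

Definition clopen_config E := open E /\ open (~` E).

Lemma clopen_measurable E : clopen_config E -> measurable E.
Proof. by move=> [oE _]; exact: sub_sigma_algebra. Qed.

Lemma clopen0 : clopen_config set0.
Proof. by split; [exact: open0|rewrite setC0; exact: openT]. Qed.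

Lemma clopenC E : clopen_config E -> clopen_config (~` E).
Proof. by move=> [oE oCE]; split; rewrite ?setCK. Qed.

Lemma clopenU E E' : clopen_config E -> clopen_config E' ->
  clopen_config (E `|` E').
Proof.
by move=> [? ?] [? ?]; split; [exact: openU|rewrite setCU; exact: openI].
Qed.

Lemma clopenI E E' : clopen_config E -> clopen_config E' ->
  clopen_config (E `&` E').
Proof.
by move=> [? ?] [? ?]; split; [exact: openI|rewrite setCI; exact: openU].
Qed.

Lemma clopen_translate g E :
  clopen_config E -> clopen_config (translate g @^-1` E).
Proof.
have tr A : open A -> open (translate g @^-1` A).
  move=> /open_agreeP oA; apply/open_agreeP => x /oA[J JA].
  exists [fset (g^-1 * v)%g | v in J]%fset => y ag; apply: JA => v vJ.
  by apply: ag; apply: in_imfset.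
by move=> [/tr oE /tr oCE]; split.
Qed.

(** Indexing by two finite sets makes these basic clopen sets a countable family when [G] is
    countable. *)
Definition pattern J K := [set x : config G | forall v, v \in J -> x v = (v \in K)].

Lemma clopen_pattern J K : clopen_config (pattern J K).
Proof.
split; apply/open_agreeP => x xJ; exists J => y ag.
  by move=> v vJ; rewrite ag ?xJ.
by move=> yJ; apply: xJ => v vJ; rewrite -ag ?yJ.
Qed.

Hypothesis G_countable : countable [set: G].

Lemma fset_countable : countable [set: {fset G} * {fset G}].
Proof.
have /countable_injP[f finj] := G_countable.
have fi : injective (fun J : {fset G} => [fset f x | x in J]%fset).
  move=> J K /fsetP JK; apply/fsetP => x.
  have inf A : (f x \in [fset f x | x in A]%fset) = (x \in A).
    apply/imfsetP/idP => [[y /= yA /finj xy]|xA]; last by exists x.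
    by rewrite xy ?inE.
  by rewrite -!inf JK.
have cf : countable [set: {fset G}].
  have /countable_injP[h hinj] := @countableP {fset nat} setT.
  apply/countable_injP; exists (fun J => h [fset f x | x in J]%fset) => J K _ _.
  by move/hinj => JK; apply: fi; apply: JK; rewrite inE.
by rewrite -setXTT; exact: countableX.
Qed.

Definition patterns : set (set (config G)) :=
  [set E | exists J K, E = pattern J K].

(** An open set is the union of the countably many patterns that it contains. *)
Lemma measurable_patterns : @measurable _ (config G) = <<s patterns >>.
Proof.
apply/seteqP; split; last first.
  apply: smallest_sub; first exact: sigma_algebra_measurable.
  by move=> _ [J [K ->]]; apply: clopen_measurable; exact: clopen_pattern.
apply: smallest_sub; first exact: smallest_sigma_algebra.
move=> E /open_agreeP oE.
pose F JK := if `[< pattern JK.1 JK.2 `<=` E >] then pattern JK.1 JK.2 else set0.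
have -> : E = \bigcup_JK F JK.
  apply/seteqP; split=> [x /oE[J JE]|x [JK _]]; last first.
    by rewrite /F; case: asboolP => // JKE; exact: JKE.
  exists (J, [fset v in J | x v]%fset) => //; rewrite /F; case: asboolP => /=.
    by move=> _ v vJ; rewrite !inE/= vJ.
  case=> y yJ; apply: JE => v vJ.
  by rewrite yJ// !inE/= vJ.
apply: (@countable_bigcupT_measurable _ (g_sigma_algebraType patterns)).
  exact: fset_countable.
move=> [J K]; rewrite /F; case: asboolP => _; last exact: measurable0.
by apply: sub_sigma_algebra; exists J, K.
Qed.

Lemma measurable_config d (T : measurableType d) (f : T -> config G) :
  (forall v, measurable [set t | f t v]) -> measurable_fun setT f.
Proof.
move=> mf; apply: (@measurability _ _ T (config G) setT f patterns).
  exact: measurable_patterns.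
move=> _ [_ [J [K ->]] <-]; rewrite setTI.
have -> : f @^-1` pattern J K =
    \big[setI/setT]_(v <- J) [set t | f t v = (v \in K)].
  by rewrite -bigcap_seq.
apply: bigsetI_measurable => v _; case: (v \in K); first exact: mf.
rewrite (_ : [set _ | _] = ~` [set t | f t v]); first exact: measurableC.
by apply/seteqP; split=> t /=; case: (f t v).
Qed.

Lemma measurable_translate g : measurable_fun setT (@translate G g).
Proof. by apply: measurable_config => v; exact: measurable_occupied. Qed.

(** Clopen events are the approximants suited to weak limits, since their indicators are continuous
    test functions. *)
Lemma measurable_clopen_approximable (R : realType)
    (mu : probability (config G) R) E :
  measurable E -> approximable mu clopen_config E.
Proof.
rewrite measurable_patterns; apply: approximable_generated.
- exact: clopen_measurable.
- exact: clopen0.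
- exact: clopenC.
- exact: clopenU.
move=> _ [J [K ->]]; split; first by apply: clopen_measurable; exact: clopen_pattern.
move=> eps e0; exists (pattern J K); first exact: clopen_pattern.
by rewrite /setY setDv setU0 /pr measure0/= ltW.
Qed.

End ConfigTopology.

Lemma clopen_indic_continuous (G : groupType) (R : realType)
  (E : set (config G)) : clopen_config E -> continuous (\1_E : config G -> R).
Proof.
move=> [oE oCE] x; apply: (@near_cst_continuous _ _ (\1_E x : R)).
have [Ex|nEx] := pselect (E x).
  have : nbhs x E by exact: open_nbhs_nbhs.
  by apply: filterS => y Ey; rewrite !indicE !mem_set.
have : nbhs x (~` E) by exact: open_nbhs_nbhs.
by apply: filterS => y Ey; rewrite !indicE !memNset.
Qed.

Lemma pr_weak_cvg (G : groupType) (R : realType)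
    (nu : nat -> probability (config G) R) mu (E : set (config G)) :
  converges_weakly nu mu -> clopen_config E ->
  pr (nu n) E @[n --> \oo] --> pr mu E.
Proof.
move=> numu cE; have mE := clopen_measurable cE.
apply: fine_cvg; rewrite fineK ?fin_num_measure//.
have := numu _ (@clopen_indic_continuous _ R _ cE).
by rewrite integral_indic// setIT; under eq_fun do rewrite integral_indic// setIT.
Qed.

(** * Percolations on Cayley graphs *)

Section Cayley.
Local Open Scope classical_set_scope.
Variables (G : groupType) (S : {fset G}).
Hypothesis S_sym : symmetric_fset S.

Lemma in_neighbours x y :
  (y \in neighbours S x) = (y != x) && ((x^-1 * y)%g \in S).
Proof.
rewrite /neighbours in_fsetD1; congr (_ && _); apply/imfsetP/idP => /=.
  by case=> s sS ->; rewrite mulKg.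
by exists (x^-1 * y)%g => //; rewrite mulVKg.
Qed.

Lemma neighbours_shift x s :
  ((x * s)%g \in neighbours S x) = (s \in neighbours S 1%g).
Proof.
rewrite !in_neighbours mulKg invg1 mul1g; congr (~~ _ && _).
by rewrite -{2}[x]mulg1 (inj_eq (mulgI x)).
Qed.

Lemma neighbours1V s : s \in neighbours S 1%g -> s^-1%g \in neighbours S 1%g.
Proof.
by rewrite !in_neighbours invg1 !mul1g invg_eq1 => /andP[-> /S_sym ->].
Qed.

(** Each vertex of the external boundary is the end of at least one edge leaving [W], so the vertex
    boundary is no larger than the edge boundary. *)
Lemma cayley_isoperimetry (R : realType) (gamma : R) (W : {fset G}) :
  ext_vertex_cheeger R S = gamma ->
  gamma * #|` W|%:R <=
  \sum_(x <- W) \sum_(s <- neighbours S 1%g) ((x * s)%g \notin W)%:R.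
Proof.
move=> <-; have [->|W0] := eqVneq W fset0.
  by rewrite cardfs0 mulr0 big_seq_fset0.
have W1 : 0 < #|` W|%:R :> R by rewrite ltr0n cardfs_gt0.
apply: (@le_trans _ _ #|` ext_boundary S W|%:R).
  rewrite -ler_pdivlMr//; apply: ge_inf; last by exists W.
  by exists 0 => r [W' _ ->].
set N := neighbours S 1%g.
have -> : #|` ext_boundary S W|%:R = \sum_(y <- ext_boundary S W) 1 :> R.
  by rewrite big_const_seq count_predT iter_addr_0.
apply: (@le_trans _ _ (\sum_(y <- ext_boundary S W)
    \sum_(x <- W) \sum_(s <- N) (y == x * s)%g%:R)).
  rewrite big_seq [leRHS]big_seq; apply: ler_sum => y.
  rewrite inE => /andP[_ /bigfcupP[x /andP[xW _] xy]].
  have yN : (x^-1 * y)%g \in N by rewrite -(neighbours_shift x) mulVKg.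
  rewrite (big_fsetD1 _ xW)/= (big_fsetD1 _ yN)/= mulVKg eqxx -addrA lerDl.
  by rewrite addr_ge0// sumr_ge0// => ? _; rewrite sumr_ge0.
rewrite exchange_big/=; apply: ler_sum => x _.
rewrite exchange_big/=; apply: ler_sum => s _.
have [xsB|xsB] := boolP ((x * s)%g \in ext_boundary S W); last first.
  rewrite big1_seq// => y /= yB; case: eqP => // yxs.
  by rewrite -yxs yB in xsB.
rewrite (big_fsetD1 _ xsB)/= eqxx big1_fset ?addr0; last first.
  by move=> y; rewrite !inE => /andP[/negbTE ->].
by move: xsB; rewrite inE => /andP[-> _].
Qed.

Hypothesis S_gen : generating S.

(** The values of words in [S] form a subgroup because [S] is symmetric, and there are countably
    many words. *)
Lemma generated_countable : countable [set: G].
Proof.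
pose ev (w : seq S) : G := foldl (fun x s => (x * val s)%g) 1%g w.
pose H := [pred x | `[< exists w, x = ev w >]].
have HS x (s : S) : x \in H -> (x * val s)%g \in H.
  move=> /asboolP[w ->]; apply/asboolP; exists (rcons w s).
  by rewrite /ev foldl_rcons.
have Hev w x : x \in H -> (x / ev w)%g \in H.
  elim/last_ind: w x => [|w s IH] x xH; first by rewrite /ev/= invg1 mulg1.
  rewrite /ev foldl_rcons -/(ev w) invgM mulgA; apply: IH.
  exact: (HS _ [` S_sym (valP s)]%fset).
have HC : group_closed H.
  split; first by apply/asboolP; exists [::].
  by move=> x y xH /asboolP[w ->]; exact: Hev.
have SH : {subset S <= H}.
  move=> s sS; apply/asboolP; exists [:: [` sS]%fset].
  by rewrite /ev/= mul1g.
have : countable (ev @` setT).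
  by apply: (sub_countable (card_image_le _ _)); exact: countableP.
apply: sub_countable; apply: subset_card_le => x _.
by have /asboolP[w ->] := S_gen HC SH x; exists w.
Qed.

Variables (R : realType) (gamma : R).
Hypothesis gamma_gt0 : 0 < gamma.
Hypothesis cheeger : ext_vertex_cheeger R S = gamma.
Hypothesis N0 : (0 < #|` neighbours S 1%g|)%N.
Local Notation N := (neighbours S 1%g).

(** The singleton of the identity as test set shows that [gamma] is at most the size of [N]. *)
Lemma cayley_gap_le1 : gap N gamma <= 1.
Proof.
have N1 : 0 < #|` N|%:R :> R by rewrite ltr0n.
have : gamma <= #|` N|%:R.
  have := cayley_isoperimetry [fset 1%g]%fset cheeger.
  rewrite cardfs1 mulr1 big_seq_fset1 => /le_trans; apply.
  apply: (@le_trans _ _ (\sum_(s <- N) 1)).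
    by apply: ler_sum => s _; rewrite lern1 leq_b1.
  by rewrite big_const_seq count_predT iter_addr_0.
rewrite /gap ler_pdivrMr ?mulr_gt0 ?exprn_gt0// mul1r => gN.
apply: (@le_trans _ _ (#|` N|%:R ^+ 2)); last first.
  by rewrite ler_peMl ?sqr_ge0// ler1n.
by rewrite ler_pXn2r// nnegrE ltW.
Qed.

(** The event is pulled back along [F] to the space of labels; by equivariance, translates of [E]
    pull back to shifts of the preimage. *)
Lemma factor_gap (I : choiceType) (act : G -> I -> I)
    (mu : probability (config G) R) :
  (forall i, act 1%g i = i) ->
  (forall g h i, act (g * h)%g i = act g (act h i)) ->
  (forall i j, exists K : {fset G}, forall g, act g i = j -> g \in K) ->
  factor_of_iid_on act mu ->
  forall E, measurable E -> event_gap mu (@translate G) N (gap N gamma / 2) E.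
Proof.
move=> act1 actM act_proper [d [T [Q [U [F [[indep unif] mF equiv muF]]]]]] E mE.
pose L t : labelling I R := fun i => U i t.
have mL : measurable_fun setT L.
  by apply: measurable_labelling => i; exact: measurable_funP.
pose X : {mfun T >-> labelling I R} := mfun_Sub (mem_set mL).
pose nu : probability (labelling I R) R := distribution Q X.
pose m (B : set R) : R := fine (uniform_prob (@ltr01 R) B).
have nu_cylinder J B : (forall i, measurable (B i)) ->
    pr nu (cylinder J B) = \prod_(i <- J) m (B i).
  move=> mB.
  have := indep J B mB; rewrite /pr => nuE.
  transitivity (fine (Q (\bigcap_(i in [set` J]) (U i @^-1` B i)))).
    by congr (fine (Q _)).
  rewrite nuE/=; apply: eq_bigr => i _.
  by rewrite /m -(unif i)// /distribution/= /pushforward.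
have mFE : measurable (F @^-1` E) by rewrite -[X in measurable X]setTI; exact: mF.
have := labels_gap nu_cylinder act1 actM act_proper neighbours1V N0
  (ltW gamma_gt0) (fun W => cayley_isoperimetry W cheeger) cayley_gap_le1 mFE.
have mt g : measurable (translate g @^-1` E).
  rewrite -[X in measurable X]setTI; apply: measurable_translate => //.
  exact: generated_countable.
have prF B : measurable B -> pr nu (F @^-1` B) = pr mu B.
  by move=> mB; rewrite /pr muF.
rewrite /event_gap prF//.
under eq_bigr => s _.
  rewrite (_ : _ `&` _ = F @^-1` (E `&` translate s @^-1` E)); last first.
    by apply/seteqP; split=> u /=; rewrite -equiv.
  rewrite prF; last exact: measurableI.
  over.
by [].
Qed.

Lemma fiid_gap (mu : probability (config G) R) : fiid S mu ->
  forall E, measurable E -> event_gap mu (@translate G) N (gap N gamma / 2) E.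
Proof.
case=> [|]; apply: factor_gap.
- by move=> i; rewrite mul1g.
- by move=> g h i; rewrite mulgA.
- move=> i j; exists [fset (j * i^-1)%g]%fset => g <-.
  by rewrite mulgK inE.
- move=> [e Pe]; apply: val_inj => /=; apply/fsetP => x.
  apply/imfsetP/idP => [[y /= ye ->]|xe]; first by rewrite mul1g.
  by exists x; rewrite ?mul1g.
- move=> g h [e Pe]; apply: val_inj => /=; apply/fsetP => x.
  apply/imfsetP/imfsetP => -[y /= ye ->].
    exists (h * y)%g; last by rewrite mulgA.
    by apply/imfsetP; exists y.
  by case/imfsetP: ye => z /= ze ->; exists z => //; rewrite mulgA.
(* If [g] maps the edge [e] onto [e'], it sends an endpoint [w] of [e] to an endpoint [z] of [e'],
   hence is one of the finitely many z w^-1. *)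
- move=> [e Pe] [e' Pe'].
  exists [fset (z * w^-1)%g | z in e', w in e]%fset => g /(congr1 val)/= ge.
  have /asboolP[x [y [_ exy]]] := Pe.
  have xe : x \in e by rewrite exy !inE eqxx.
  have gxe : (g * x)%g \in e' by rewrite -ge; apply: in_imfset.
  by apply/imfset2P; exists (g * x)%g => //; exists x => //; rewrite mulgK.
Qed.

(** For a clopen event both sides of the inequality are continuous functions of finitely many clopen
    probabilities, so it survives the weak limit; approximation extends it to all events. *)
Lemma weak_fiid_gap (mu : probability (config G) R) :
  site_percolation mu -> weak_fiid S mu ->
  forall E, measurable E -> event_gap mu (@translate G) N (gap N gamma / 2) E.
Proof.
move=> inv_mu [nu fiid_nu numu] E mE.
have gap0 := gap_ge0 N gamma.
have mtr := measurable_translate generated_countable.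
apply: (event_gap_approx mtr inv_mu) => //.
  move: gap0 cayley_gap_le1; set k := gap N gamma => k0 k1.
  apply/andP; split; first by rewrite divr_ge0.
  by rewrite ler_pdivrMr// mul1r (le_trans k1)// ler1n.
move=> eps e0.
have [_ /(_ _ e0)[E' cE' EE']] := measurable_clopen_approximable generated_countable mu mE.
exists E'; split=> //; first exact: clopen_measurable.
have cvE' := pr_weak_cvg numu cE'.
have cvL : \sum_(s <- N) pr (nu n) (E' `&` translate s @^-1` E') @[n --> \oo] -->
    \sum_(s <- N) pr mu (E' `&` translate s @^-1` E').
  apply: cvg_big => [|s _]; first exact: add_continuous.
  by apply: pr_weak_cvg => //; apply: clopenI => //; exact: clopen_translate.
have cvR : #|` N|%:R * (gap N gamma / 2 * pr (nu n) E' ^+ 2 +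
      (1 - gap N gamma / 2) * pr (nu n) E') @[n --> \oo] -->
    #|` N|%:R * (gap N gamma / 2 * pr mu E' ^+ 2 + (1 - gap N gamma / 2) * pr mu E').
  by apply: cvgMl_tmp; apply: cvgD; apply: cvgMl_tmp => //; exact: cvgM.
apply: (ler_cvg_to cvL cvR); apply: nearW => n.
by apply: (fiid_gap (fiid_nu n)); exact: clopen_measurable.
Qed.

End Cayley.

(** * Clusters *)

Section Clusters.
Local Open Scope classical_set_scope.
Variables (G : groupType) (S : {fset G}).
Implicit Types (x : config G) (v w : G) (B : set (config G)).

Lemma adjacent_mul g v w : Defs.adjacent S (g * v)%g (g * w)%g = Defs.adjacent S v w.
Proof.
by rewrite /Defs.adjacent !in_neighbours (inj_eq (mulgI g)) invgM mulgA mulgVK.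
Qed.

Lemma cluster_translate g x v :
  cluster_of S (translate g x) (g * v)%g = translate g (cluster_of S x v).
Proof.
have half h y u w : cluster_of S y u w ->
    cluster_of S (translate h y) (h * u)%g (h * w)%g.
  move=> /asboolP[p [pp ap lp]]; apply/asboolP.
  exists [seq (h * z)%g | z <- p]; split.
  - by rewrite path_map; apply: sub_path pp => a b; rewrite /= adjacent_mul.
  - rewrite -map_cons all_map; apply: sub_all ap => a.
    by rewrite /= /translate mulKg.
  - by rewrite last_map lp.
apply/funext => w; rewrite /translate; apply/idP/idP => [/(half g^-1%g)|/(half g)].
  rewrite mulKg; congr (is_true (cluster_of S _ v _)).
  by apply/funext => a; rewrite /translate invgK mulKg.
by rewrite mulVKg.
Qed.

Lemma cluster_adjacent x v w : Defs.adjacent S v w -> Defs.adjacent S w v ->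
  x v -> x w -> cluster_of S x v = cluster_of S x w.
Proof.
have half a b u : Defs.adjacent S b a -> x b -> cluster_of S x a u -> cluster_of S x b u.
  move=> ba xb /asboolP[p [pp ap lp]]; apply/asboolP.
  by exists (a :: p); rewrite /= ba xb.
by move=> vw wv xv xw; apply/funext => u; apply/idP/idP; exact: half.
Qed.

Hypothesis G_countable : countable [set: G].

(** That [w] lies in the cluster of [v] is a countable union, over the paths joining them, of finite
    intersections of occupation events. *)
Lemma measurable_cluster v : measurable_fun setT (fun x => cluster_of S x v).
Proof.
apply: (measurable_config G_countable) => w.
have seq_countable : countable [set: seq G].
  have /countable_injP[f finj] := G_countable.
  have /countable_injP[h hinj] := @countableP (seq nat) setT.
  apply/countable_injP; exists (h \o map f) => p q _ _ /= /hinj pq.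
  apply: (inj_map (f := f)); last by apply: pq; rewrite inE.
  by move=> a b; apply: finj; rewrite inE.
pose F p : set (config G) := if path (Defs.adjacent S) v p && (last v p == w)
  then \big[setI/setT]_(u <- v :: p) @occupied G u else set0.
have -> : [set x | cluster_of S x v w] = \bigcup_p F p.
  apply/seteqP; split=> x /=.
    move=> /asboolP[p [pp ap /eqP lp]]; exists p => //; rewrite /F pp lp -bigcap_seq.
    by move=> u /= up; exact: (allP ap).
  move=> [p _]; rewrite /F; case: ifPn => // /andP[pp /eqP lp].
  rewrite -bigcap_seq => xp; apply/asboolP; exists p; split=> //.
  by apply/allP => u up; exact: xp.
apply: countable_bigcupT_measurable => // p; rewrite /F; case: ifPn => // _.
by apply: bigsetI_measurable => u _; exact: measurable_occupied.
Qed.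

Lemma deg_in_sum (R : realType) x v :
  (deg_in S x v)%:R = \sum_(u <- neighbours S v) \1_(@occupied G u) x :> R.
Proof.
rewrite /deg_in.
have -> : #|` [fset u in neighbours S v | x u]|%:R =
    \sum_(u <- [fset u in neighbours S v | x u]) 1 :> R.
  by rewrite big_const_seq count_predT iter_addr_0.
rewrite (big_fsetID _ (fun u => x u) (neighbours S v))/=.
rewrite [X in _ = _ + X]big1_fset ?addr0; last first.
  by move=> u; rewrite !inE/= => /andP[_ /negbTE xu] _; rewrite indicE memNset//= /occupied/= xu.
rewrite big_seq [RHS]big_seq; apply: eq_bigr => u; rewrite !inE/= => /andP[_ xu].
by rewrite indicE mem_set.
Qed.

(** Occupation is demanded separately: the cluster of an unoccupied vertex is empty, and [B] may
    contain the empty configuration. *)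
Definition in_cluster_class B : set (config G) :=
  @occupied G 1%g `&` [set x | B (cluster_of S x 1%g)].

Lemma measurable_cluster_class B : measurable B ->
  measurable [set x | B (cluster_of S x 1%g)].
Proof.
by move=> mB; rewrite -[X in measurable X]setTI; exact: measurable_cluster.
Qed.

Lemma measurable_in_cluster_class B : measurable B ->
  measurable (in_cluster_class B).
Proof.
move=> mB; apply: measurableI; first exact: measurable_occupied.
exact: measurable_cluster_class.
Qed.

Hypothesis S_sym : symmetric_fset S.
Local Notation N := (neighbours S 1%g).

(** An occupied neighbour [s] of the identity shares its cluster, and translation by [s^-1] moves
    [s] to the identity. *)
Lemma in_cluster_class_translate B s x : invariant_set B -> s \in N ->
  in_cluster_class B x -> x s -> in_cluster_class B (translate s^-1%g x).
Proof.
move=> invB sN [x1 BC] xs; split.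
  by rewrite /occupied/= /translate invgK mulg1.
rewrite /= -[X in cluster_of S _ X](mulVg s) cluster_translate; apply/invB.
rewrite -(@cluster_adjacent x 1%g s)//.
by rewrite /Defs.adjacent -(mulgV s) neighbours_shift; exact: neighbours1V.
Qed.

Variables (R : realType) (mu : probability (config G) R) (phi : config G -> R).
Hypothesis phiP : is_average_degree S mu phi.

Lemma pr_cond_law A : measurable A -> 0 < pr mu (@occupied G 1%g) ->
  pr (cond_law mu) A = pr mu (A `&` @occupied G 1%g) / pr mu (@occupied G 1%g).
Proof.
move=> mA p0; have mo := @measurable_occupied G 1%g.
(* Normalisation falls back to [mu] when the conditioning event has mass zero or infinity; [p0]
   rules this out. *)
transitivity (fine ((if (mu (setT `&` @occupied G 1%g) == 0) ||
    (mu (setT `&` @occupied G 1%g) == +oo) then fun U => mu U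
  else fun U => mu (U `&` @occupied G 1%g) *
    (fine (mu (setT `&` @occupied G 1%g)))^-1%:E) A)%E); first by [].
rewrite setTI (prE _ mo) eqe gt_eqF//=.
by rewrite (prE _ (measurableI _ _ mA mo)) -EFinM.
Qed.

(** The event that the cluster lies in [B] belongs to the conditioning sigma-field, so the degree
    integrates over it to the integral of [phi], which is at least [c] there. The degree is a sum of
    occupation indicators, and occupied neighbours lie in the same cluster. *)
Lemma average_degree_le_correlation B (c : R) : measurable B ->
  invariant_set B -> (forall C, B C -> c <= phi C) ->
  c * pr mu (in_cluster_class B) <= \sum_(s <- N)
    pr mu (in_cluster_class B `&` translate s @^-1` in_cluster_class B).
Proof.
move=> mB invB Bc; have mo := @measurable_occupied G.
set E := in_cluster_class B; pose E' := [set x | B (cluster_of S x 1%g)].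
have mE' : measurable E' by exact: measurable_cluster_class.
have mE : measurable E by exact: measurable_in_cluster_class.
have p_le : pr mu E <= pr mu (@occupied G 1%g) by apply: le_pr => // x [].
have [p0|p0] := leP (pr mu (@occupied G 1%g)) 0.
  have -> : pr mu E = 0 by apply/le_anti; rewrite (le_trans p_le p0) pr_ge0.
  by rewrite mulr0 sumr_ge0// => s _; exact: pr_ge0.
have [mphi invphi [_ iphi /(_ E')]] := phiP.
have fieldE' : cluster_sigma_field S E'.
  by apply: sub_sigma_algebra; exists B.
move=> /(_ fieldE') cond.
have lower : c * pr (cond_law mu) E' <= \sum_(s <- N) pr (cond_law mu) (@occupied G s `&` E').
  rewrite -lee_fin.
  have -> : (\sum_(s <- N) pr (cond_law mu) (@occupied G s `&` E'))%:E =
     (\int[cond_law mu]_(x in E') (deg_in S x 1%g)%:R%:E)%E.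
    under eq_integral do rewrite deg_in_sum -sumEFin.
    rewrite integral_sum//; last first.
      move=> s; apply: (@integrableS _ _ _ _ setT) => //.
      exact: integrable_indic.
    rewrite -sumEFin; apply: eq_bigr => s _.
    rewrite integral_indic//; apply/esym/prE; exact: measurableI.
  rewrite -cond EFinM.
  have -> : (c%:E * (pr (cond_law mu) E')%:E)%E = (\int[cond_law mu]_(x in E') c%:E)%E.
    by rewrite integral_cst//; congr (_ * _)%E; apply/esym/prE.
  apply: le_integral => //.
  - apply: (@integrableS _ _ _ _ setT) => //.
    exact: (finite_measure_integrable_cst (cond_law mu) c).
  - by apply: (@integrableS _ _ _ _ setT).
  - by move=> x; rewrite inE => E'x; rewrite lee_fin; exact: Bc.
rewrite pr_cond_law// in lower.
have step : c * pr mu (E' `&` @occupied G 1%g) <=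
    \sum_(s <- N) pr mu (@occupied G s `&` E' `&` @occupied G 1%g).
  rewrite -(ler_pM2r (x := (pr mu (@occupied G 1%g))^-1)) ?invr_gt0//.
  rewrite -mulrA; apply: (le_trans lower).
  rewrite mulr_suml; apply: ler_sum => s _; rewrite pr_cond_law//.
  exact: measurableI.
rewrite /E /in_cluster_class setIC; apply: (le_trans step).
(* Reindexing by inverses: the term for an occupied neighbour [s] is matched with translation by
   [s^-1]. *)
rewrite -[leRHS](perm_big _ (steps_inv (neighbours1V S_sym))) big_map/=.
rewrite big_seq [leRHS]big_seq; apply: ler_sum => s sN.
apply: le_pr.
- by apply: measurableI => //; apply: measurableI.
- apply: measurableI; first by rewrite setIC.
  rewrite -[X in measurable X]setTI; apply: measurable_translate => //.
  by rewrite setIC.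
- move=> x [[xs E'x] x1]; split; first by [].
  rewrite setIC; exact: in_cluster_class_translate.
Qed.

End Clusters.

(** * From correlations to the dichotomy *)

Section Conclusion.
Local Open Scope classical_set_scope.

Lemma invariant_setI (G : groupType) (A B : set (config G)) :
  invariant_set A -> invariant_set B -> invariant_set (A `&` B).
Proof.
by move=> iA iB g x; have := iA g x; have := iB g x; rewrite /setI/=; tauto.
Qed.

(** By invariance the event is null when seen from any vertex, and every cluster is the cluster of
    one of the countably many vertices. *)
Lemma in_cluster_class_null_ae (G : groupType) (S : {fset G}) (R : realType)
    (disp : measure_display) (T : measurableType disp) (P : probability T R)
    (X : {RV P >-> config G}) (B : set (config G)) :
  countable [set: G] -> site_percolation (distribution P X) ->
  measurable B -> invariant_set B ->
  pr (distribution P X) (in_cluster_class S B) = 0 ->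
  {ae P, forall t, forall C, is_cluster S (X t) C -> ~ B C}.
Proof.
move=> cG invX mB invB E0; have mE := measurable_in_cluster_class S cG mB.
have /countable_injP[f finj] := cG.
(* Vertices are enumerated through the injection [f]; the condition is vacuous for [n] outside its
   range. *)
pose Q n t := forall v, f v = n -> ~ in_cluster_class S B (translate v^-1%g (X t)).
have aeQ n : {ae P, forall t, Q n t}.
  have [[v fv]|nv] := pselect (exists v, f v = n); last first.
    by apply: aeW => t v fv; case: nv; exists v.
  have mv : measurable (translate v^-1%g @^-1` in_cluster_class S B).
    rewrite -[X in measurable X]setTI.
    exact: measurable_translate.
  exists (X @^-1` (translate v^-1%g @^-1` in_cluster_class S B)); split.
  - by rewrite -[Y in measurable Y]setTI; exact: measurable_funP.
  - rewrite -[LHS]/(distribution P X (translate v^-1%g @^-1` in_cluster_class S B)).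
    by rewrite invX// prE// E0.
  - move=> t /= nQ; apply: contrapT => nE; apply: nQ => w fw.
    by have -> : w = v by apply: finj; rewrite ?inE// fw fv.
apply: filterS (ae_foralln aeQ) => t Qt C [v xv ->] BC.
apply: (Qt (f v) v erefl); split.
  by rewrite /occupied/= /translate invgK mulg1.
by rewrite /= -(mulVg v) cluster_translate; apply/invB.
Qed.

Lemma small_correlation_zero (R : realFieldType) (n kappa delta p L : R) :
  0 < n -> 0 <= kappa -> 0 <= p -> p <= 1 / 2 -> 2 * delta < kappa ->
  n * (1 - delta) * p <= L -> L <= n * (kappa * p ^+ 2 + (1 - kappa) * p) ->
  p = 0.
Proof.
move=> n0 kap0 p0 p2 dk lo up; apply: contrapT => /eqP pn0.
have {}p0 : 0 < p by rewrite lt_def pn0.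
have np : 0 < n * p by rewrite mulr_gt0.
have : n * p * (1 - delta) <= n * p * (kappa * p + (1 - kappa)).
  have -> : n * p * (1 - delta) = n * (1 - delta) * p by ring.
  have -> : n * p * (kappa * p + (1 - kappa)) =
    n * (kappa * p ^+ 2 + (1 - kappa) * p) by ring.
  exact: le_trans up.
rewrite ler_pM2l// => h.
have k0 : kappa * (1 - p) <= delta by lra.
have : kappa * (1 / 2) <= kappa * (1 - p) by rewrite ler_wpM2l//; lra.
lra.
Qed.

End Conclusion.

Theorem corollary1p7 (R : realType) (gamma : R) (d : nat)
    (gamma_gt0 : 0 < gamma) (d_ge3 : (3 <= d)%N) :
  exists2 delta : R, 0 < delta &
  forall (G : groupType) (S : {fset G}),
    infinite_set [set: G] -> symmetric_fset S -> generating S ->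
    graph_degree S d -> ext_vertex_cheeger R S = gamma ->
  forall (disp : measure_display) (T : measurableType disp)
         (P : probability T R) (X : {RV P >-> config G}),
    site_percolation (distribution P X) ->
    fiid S (distribution P X) \/ weak_fiid S (distribution P X) ->
  forall phi : config G -> R, is_average_degree S (distribution P X) phi ->
  forall A : set (config G), measurable A -> invariant_set A ->
    {ae P, forall t, forall C, is_cluster S (X t) C -> infinite_config C ->
       d%:R * (1 - delta) <= phi C -> A C} \/
    {ae P, forall t, forall C, is_cluster S (X t) C -> infinite_config C ->
       d%:R * (1 - delta) <= phi C -> ~ A C}.
Proof.
have d0 : 0 < d%:R :> R by rewrite ltr0n (leq_trans _ d_ge3).
(* This is half of [gap], written with [d] for the size of the neighbourhood so that it is fixed
   before the group is chosen. *)
pose kappa : R := gamma ^+ 2 / (8 * d%:R ^+ 2) / 2.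
have k0 : 0 < kappa by rewrite !divr_gt0 ?mulr_gt0 ?exprn_gt0.
(* Any positive value below [kappa / 2] would do for [small_correlation_zero]. *)
exists (kappa / 4); first by rewrite divr_gt0.
set c := d%:R * (1 - kappa / 4).
move=> G S _ S_sym S_gen S_deg cheeger disp T P X invX X_fiid phi phiP A mA invA.
set mu := distribution P X in invX X_fiid phiP.
have cG := generated_countable S_sym S_gen.
have Nd : #|` neighbours S 1%g| = d by exact: S_deg.
have N0 : (0 < #|` neighbours S 1%g|)%N by rewrite Nd (leq_trans _ d_ge3).
have event E : measurable E ->
    event_gap mu (@translate G) (neighbours S 1%g) kappa E.
  rewrite /kappa -Nd -/(gap _ gamma); case: X_fiid => fX.
    exact: fiid_gap.
  exact: weak_fiid_gap.
pose D : set (config G) := [set C | c <= phi C].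
have mD : measurable D.
  have [mphi _ _] := phiP.
  have -> : D = phi @^-1` `[c, +oo[.
    by apply/seteqP; split=> C /=; rewrite in_itv/= andbT.
  by rewrite -[Y in measurable Y]setTI; exact: mphi.
have invD : invariant_set D.
  by have [_ iphi _] := phiP; move=> g C; rewrite /D/= iphi.
have null B : measurable B -> invariant_set B ->
    pr mu (in_cluster_class S (D `&` B)) <= 1 / 2 ->
    pr mu (in_cluster_class S (D `&` B)) = 0.
  move=> mB invB p2; have mDB : measurable (D `&` B) by exact: measurableI.
  have invDB := invariant_setI invD invB.
  have lo := average_degree_le_correlation cG S_sym phiP mDB invDB
    (fun C => @proj1 _ _).
  have up := event _ (measurable_in_cluster_class S cG mDB).
  apply: (small_correlation_zero d0 (ltW k0) (pr_ge0 _ _) p2 _ lo).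
    lra.
  by move: up; rewrite /event_gap Nd.
have ae B : measurable B -> invariant_set B ->
    pr mu (in_cluster_class S (D `&` B)) = 0 ->
    {ae P, forall t, forall C, is_cluster S (X t) C -> infinite_config C ->
       c <= phi C -> ~ B C}.
  move=> mB invB p0; have := @in_cluster_class_null_ae G S R _ _ P X (D `&` B).
  move=> /(_ cG invX (measurableI _ _ mD mB) (invariant_setI invD invB) p0).
  by apply: filterS => t ht C /ht nDB _ DC BC; apply: nDB.
have mCA : measurable (~` A) by exact: measurableC.
have invCA : invariant_set (~` A).
  by move=> g C; have := invA g C; rewrite /=; tauto.
(* The classes for [A] and its complement give disjoint events, so one of them has probability at
   most 1/2 and is therefore null. *)
have [pA|pA] := leP (pr mu (in_cluster_class S (D `&` A))) (1 / 2).
  by right; apply: ae => //; exact: null.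
have pCA : pr mu (in_cluster_class S (D `&` ~` A)) <= 1 / 2.
  have mE B : measurable B -> measurable (in_cluster_class S (D `&` B)).
    by move=> mB; apply: measurable_in_cluster_class => //; exact: measurableI.
  have : pr mu (in_cluster_class S (D `&` A) `|` in_cluster_class S (D `&` ~` A)) <= 1.
    by apply: pr_le1; apply: measurableU; exact: mE.
  rewrite pr_setU; [lra|exact: mE..|].
  by apply/seteqP; split=> x //= [ [_ [_ Ax]] [_ [_ nAx]]].
left; apply: filterS (ae _ mCA invCA (null _ mCA invCA pCA)) => t ht C cC iC DC.
by apply: contrapT; exact: ht.
Qed.
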